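(* Let $G$ be a group generated by a polynomial automaton of degree $d$. Then $\mathrm{WP}_G\in\mathrm{DTIME}_*\big(n(\log n)^{(d+1)^2}\big)$. If moreover $G$ is contracting, then $\mathrm{WP}_G\in\mathrm{DTIME}_*\big(n(\log n)^{d+1}\big)$.
   Context: An automaton over a finite alphabet $X$ is $A=(S,X,t,o)$ with finite state set $S$, transition map $t:S\times X\to S$, output map $o:S\times X\to X$, extended to words by $t(s,xv)=t(t(s,x),v)$, $o(s,xv)=o(s,x)o(t(s,x),v)$. It is assumed invertible, minimal (distinct states define distinct transformations of $X^{*}$), with $S$ closed under inversion; $G$ is the group of transformations $o(s,\cdot)$ of $X^{*}$ generated by $S$. For $s\in S$, $v\in X^{*}$, $s|_v=t(s,v)$, and for a word $w=s_1\cdots s_n\in S^{*}$ and $x\in X$, the section $w|_x=s_1'\cdots s_n'$ with $s_i'=t(s_i,x_i)$, $x_1=x$, $x_{i+1}=o(s_i,x_i)$. The trivial state $e$ is the state acting as the identity. The automaton is polynomial if there is a polynomial $P$ such that for every $s\in S$ and $n\in\mathbb{N}$ at most $P(n)$ words $v\in X^n$ satisfy $s|_v\neq e$; its degree is the least degree of such $P$. $G$ is contracting (for this automaton) if $l_S(w|_x)<|w|$ for all $x\in X$ and all sufficiently long $w\in S^{*}$, where $l_S$ is word length in $G$. $\mathrm{WP}_G=\{w\in S^{*}: w=_Ge\}$; $\mathrm{DTIME}_*(t(n))$ is the class of languages decided in time $O(t(n))$ by a deterministic multi-tape Turing machine. *)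

(* Defs.v *)
From mathcomp Require Import all_boot all_algebra.
From Stdlib Require Reals.
Notation R := Rdefinitions.R.
Notation Rle := Rdefinitions.Rle.
Notation Rplus := Rdefinitions.Rplus.
Notation Rmult := Rdefinitions.Rmult.
Notation INR := Raxioms.INR.
Notation ln := Rpower.ln.
Notation Rpow := Rpow_def.pow.
Set Implicit Arguments. Unset Strict Implicit. Unset Printing Implicit Defensive.
Import GRing.Theory Num.Theory.

Section Automata.
Variables (X S : finType) (t : S -> X -> S) (o : S -> X -> X).

Definition trans (s : S) (w : seq X) : S := foldl t s w.

Fixpoint out (s : S) (w : seq X) : seq X :=
  match w with
  | [::] => [::]
  | x :: v => o s x :: out (t s x) v
  end.

Definition invertible := forall s : S, injective (o s).

Definition minimal :=
  forall s1 s2 : S, (forall w, out s1 w = out s2 w) -> s1 = s2.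

Definition closed_under_inversion :=
  forall s : S, exists s' : S, forall w, out s' (out s w) = w.

Definition nontrivial_state (s : S) : Prop := exists w, out s w <> w.

Definition poly_bounded (d : nat) : Prop :=
  exists P : {poly rat}, (size P <= d.+1)%N /\
    forall (s : S) (n : nat) (V : {set n.-tuple X}),
      (forall v, v \in V -> nontrivial_state (trans s (tval v))) ->
      ((#|V|)%:R <= P.[n%:R])%R.

Definition polynomial_automaton := exists d, poly_bounded d.

Definition automaton_degree (d : nat) : Prop :=
  poly_bounded d /\ forall d', poly_bounded d' -> (d <= d')%N.

Definition act_word (w : seq S) (v : seq X) : seq X :=
  foldl (fun u s => out s u) v w.

Definition WP (w : seq S) : Prop := forall v, act_word w v = v.

Fixpoint section_word (w : seq S) (x : X) : seq S :=
  match w with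
  | [::] => [::]
  | s :: w' => t s x :: section_word w' (o s x)
  end.

Definition contracting : Prop :=
  exists N : nat, forall w : seq S, (N <= size w)%N -> forall x : X,
    exists w' : seq S,
      (forall v, act_word w' v = act_word (section_word w x) v) /\
      (size w' < size w)%N.

End Automata.

(* Machine over input alphabet Sigma with k.+1 tapes (tape 0 = input tape).
   Head moves are coded by 'I_3 : 0 = left, 1 = stay, 2 = right. *)
Record TM (Sigma : finType) := MkTM {
  tm_k : nat;
  tm_Q : finType;
  tm_G : finType;
  tm_blank : tm_G;
  tm_inp : Sigma -> tm_G;
  tm_inp_inj : injective tm_inp;
  tm_blank_new : forall a, tm_inp a <> tm_blank;
  tm_q0 : tm_Q;
  tm_halt : pred tm_Q;
  tm_acc : pred tm_Q;
  tm_delta : tm_Q -> {ffun 'I_tm_k.+1 -> tm_G} ->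
             tm_Q * {ffun 'I_tm_k.+1 -> tm_G} * {ffun 'I_tm_k.+1 -> 'I_3}
}.
Arguments tm_k {Sigma} t. Arguments tm_Q {Sigma} t. Arguments tm_G {Sigma} t.
Arguments tm_blank {Sigma} t. Arguments tm_inp {Sigma} t a.
Arguments tm_q0 {Sigma} t. Arguments tm_halt {Sigma} t. Arguments tm_acc {Sigma} t.
Arguments tm_delta {Sigma} t q r.

Section TMsem.
Variables (Sigma : finType) (M : TM Sigma).

Record config := MkConfig {
  c_state : tm_Q M;
  c_tape : 'I_(tm_k M).+1 -> int -> tm_G M;
  c_head : 'I_(tm_k M).+1 -> int
}.

Definition tm_step (c : config) : config :=
  if tm_halt M (c_state c) then c else
  let r := [ffun i => c_tape c i (c_head c i)] in
  let '(q', wr, mv) := tm_delta M (c_state c) r in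
  MkConfig q'
    (fun i p => if p == c_head c i then wr i else c_tape c i p)
    (fun i => (c_head c i + (nat_of_ord (mv i))%:Z - 1)%R).

Definition init_config (w : seq Sigma) : config :=
  MkConfig (tm_q0 M)
    (fun i p =>
       if i == ord0 then
         match p with
         | Posz m => match onth w m with Some a => tm_inp M a | None => tm_blank M end
         | Negz _ => tm_blank M
         end
       else tm_blank M)
    (fun _ => 0%R).

Definition run (n : nat) (w : seq Sigma) : config := iter n tm_step (init_config w).

Definition decides_within (L : seq Sigma -> Prop) (T : nat -> R) : Prop :=
  forall w : seq Sigma, exists n : nat,
    Rle (INR n) (T (size w)) /\
    tm_halt M (c_state (run n w)) /\
    (tm_acc M (c_state (run n w)) <-> L w).

End TMsem.

Definition DTIME_star (Sigma : finType) (f : nat -> R) (L : seq Sigma -> Prop) : Prop :=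
  exists (M : TM Sigma) (C : R),
    decides_within M L (fun n => Rplus (Rmult C (f n)) C).

Definition n_logpow (k : nat) (n : nat) : R := Rmult (INR n) (Rpow (ln (INR n)) k).

(* Main.v *)
From HB Require Import structures.
Require Import Defs.
From mathcomp Require Import all_boot all_order all_algebra zify.
From Stdlib Require Import Classical FunctionalExtensionality Lra.
From Stdlib Require Reals.
Set Implicit Arguments. Unset Strict Implicit. Unset Printing Implicit Defensive.

(** Reading a word [w] of length [n] on a letter [x] either moves [x], so that
    [w] is nontrivial, or leaves the section of [w] at [x] to be tested. Keeping
    only the nontrivial letters of the sections, the sections at level [l] have
    total length [O(n * l ^ d)], because each letter of [w] acts on level [l]
    through a permutation and has at most [P l] nontrivial sections there. So a
    level-by-level search down to depth [D] costs [O(n * D ^ (d + 1))], and it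
    remains to see how deep a nontrivial word of length [n] must be searched.

    If [G] is contracting, sections of length [n] become bounded after [O(log n)]
    levels, so [D = O(log n)].

    In general [D = O((log n) ^ (d + 1))], by induction on the degree. After
    boundedly many levels a letter of top degree either drops in degree or follows
    a periodic special ray on which it keeps its degree. Two neighbouring special
    letters that survive together for as many levels as are needed for the
    lower-degree word between them to become periodic have special rays matched
    exactly by that word; from then on they survive or die together. Splitting
    [w] dyadically, after [log n] such rounds all surviving special letters of
    each section form one cluster. Either it dies and the degree drops, or the
    section becomes periodic along its special ray. Either way a long ray passes
    twice through the same section, and the path between the two can be cut out. *)

(** * Sections along infinite rays *)

Section Rays.
Variables (X S : finType) (t : S -> X -> S) (o : S -> X -> X).

(** Rays are infinite so that periodicity makes sense; level [k] depends only on the first [k]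
    letters, by [st_agree] and its companions. *)
Fixpoint st (s : S) (xi : nat -> X) (k : nat) : S :=
  if k is k'.+1 then t (st s xi k') (xi k') else s.

Definition ro (s : S) (xi : nat -> X) (k : nat) : X := o (st s xi k) (xi k).

Definition rw (w : seq S) (xi : nat -> X) : nat -> X :=
  foldl (fun eta s => ro s eta) xi w.

Fixpoint sec (w : seq S) (xi : nat -> X) (k : nat) : seq S :=
  if w is s :: w' then st s xi k :: sec w' (ro s xi) k else [::].

Definition agree (k : nat) (xi eta : nat -> X) := forall i, i < k -> xi i = eta i.

Definition tail (k : nat) (xi : nat -> X) : nat -> X := fun i => xi (k + i).

Definition glue (k : nat) (xi eta : nat -> X) : nat -> X :=
  fun i => if i < k then xi i else eta (i - k).

Definition olet (w : seq S) (x : X) : X := foldl (fun y s => o s y) x w.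

Lemma agree_le k k' xi eta : k' <= k -> agree k xi eta -> agree k' xi eta.
Proof. by move=> le_k ag i lti; apply: ag; apply: leq_trans le_k. Qed.

Lemma agree_sym k xi eta : agree k xi eta -> agree k eta xi.
Proof. by move=> ag i lti; rewrite ag. Qed.

Lemma agree_trans k xi eta zeta : agree k xi eta -> agree k eta zeta -> agree k xi zeta.
Proof. by move=> a1 a2 i lti; rewrite a1 // a2. Qed.

Lemma st_agree k s xi eta : agree k xi eta -> st s xi k = st s eta k.
Proof.
elim: k => //= k IHk ag.
by rewrite IHk ?ag //; apply: agree_le ag.
Qed.

Lemma ro_agree k s xi eta : agree k xi eta -> agree k (ro s xi) (ro s eta).
Proof.
move=> ag i lti; rewrite /ro ag // (@st_agree i s xi eta) //.
by apply: agree_le ag; exact: ltnW.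
Qed.

Lemma rw_agree k w xi eta : agree k xi eta -> agree k (rw w xi) (rw w eta).
Proof. by elim: w xi eta => //= s w IHw xi eta /(ro_agree s); apply: IHw. Qed.

Lemma sec_agree k w xi eta : agree k xi eta -> sec w xi k = sec w eta k.
Proof.
elim: w xi eta => //= s w IHw xi eta ag.
by rewrite (st_agree s ag) (IHw _ (ro s eta)) //; exact: ro_agree.
Qed.

Lemma st_add s xi k i : st s xi (k + i) = st (st s xi k) (tail k xi) i.
Proof. by elim: i => [|i IHi]; rewrite ?addn0 ?addnS //= IHi. Qed.

Lemma ro_tail s xi k : ro (st s xi k) (tail k xi) = tail k (ro s xi).
Proof. by apply: functional_extensionality => i; rewrite /tail /ro st_add. Qed.

Lemma sec_add w xi k i : sec w xi (k + i) = sec (sec w xi k) (tail k xi) i.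
Proof. by elim: w xi => //= s w IHw xi; rewrite st_add IHw ro_tail. Qed.

Lemma rw_tail w xi k : rw (sec w xi k) (tail k xi) = tail k (rw w xi).
Proof. by elim: w xi => //= s w IHw xi; rewrite ro_tail IHw. Qed.

Lemma sec0 w xi : sec w xi 0 = w.
Proof. by elim: w xi => //= s w IHw xi; rewrite IHw. Qed.

Lemma sec_cat w1 w2 xi k : sec (w1 ++ w2) xi k = sec w1 xi k ++ sec w2 (rw w1 xi) k.
Proof. by elim: w1 xi => //= s w1 IHw xi; rewrite IHw. Qed.

Lemma rw_cat w1 w2 xi : rw (w1 ++ w2) xi = rw w2 (rw w1 xi).
Proof. by rewrite /rw foldl_cat. Qed.

Lemma size_sec w xi k : size (sec w xi k) = size w.
Proof. by elim: w xi => //= s w IHw xi; rewrite IHw. Qed.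

Lemma agree_glue k xi eta : agree k (glue k xi eta) xi.
Proof. by move=> i lti; rewrite /glue lti. Qed.

Lemma tail_glue k xi eta : tail k (glue k xi eta) = eta.
Proof.
apply: functional_extensionality => i.
by rewrite /tail /glue ltnNge leq_addr /= addKn.
Qed.

Lemma sec_glue w xi eta k i : sec w (glue k xi eta) (k + i) = sec (sec w xi k) eta i.
Proof. by rewrite sec_add tail_glue (sec_agree w (agree_glue (k := k) xi eta)). Qed.

Lemma rwE w xi k : rw w xi k = olet (sec w xi k) (xi k).
Proof. by elim: w xi => //= s w IHw xi; rewrite IHw. Qed.

Lemma secS w xi k : sec w xi k.+1 = section_word t o (sec w xi k) (xi k).
Proof. by elim: w xi => //= s w IHw xi; rewrite IHw. Qed.

(** * Preimages of rays and eventual periodicity *)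

Hypothesis o_inj : invertible o.

Lemma agree_ro k s xi eta : agree k (ro s xi) (ro s eta) -> agree k xi eta.
Proof.
elim: k => [|k IHk] ag i //; rewrite ltnS leq_eqVlt => /orP[/eqP->|lti]; last first.
  by apply: IHk lti; apply: agree_le ag.
have ag' : agree k xi eta by apply: IHk; apply: agree_le ag.
by have := ag k (ltnSn k); rewrite /ro (st_agree s ag') => /o_inj.
Qed.

Lemma agree_rw k w xi eta : agree k (rw w xi) (rw w eta) -> agree k xi eta.
Proof. by elim: w xi eta => //= s w IHw xi eta /IHw /agree_ro. Qed.

(** The run of the inverse automaton: the output ray [eta] is given and each input letter is
    recovered from it. *)
Fixpoint ist (s : S) (eta : nat -> X) (k : nat) : S :=
  if k is k'.+1 then
    let q := ist s eta k' in t q (invF (@o_inj q) (eta k')) else s.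

Lemma ro_surj s eta : exists xi, ro s xi = eta.
Proof.
pose xi k := invF (@o_inj (ist s eta k)) (eta k).
have Est k : st s xi k = ist s eta k by elim: k => //= k ->.
by exists xi; apply: functional_extensionality => k; rewrite /ro Est f_invF.
Qed.

Lemma rw_surj w eta : exists xi, rw w xi = eta.
Proof.
elim/last_ind: w eta => [|w s IHw] eta; first by exists eta.
have [zeta <-] := ro_surj s eta; have [xi <-] := IHw zeta.
by exists xi; rewrite -cats1 rw_cat.
Qed.

Variable p : nat.
Hypothesis p_gt0 : 0 < p.

Definition perfrom (E : nat) (xi : nat -> X) := forall k, E <= k -> xi (k + p) = xi k.

(** A window of length [E + p] contains the preperiod and one full period. *)
Lemma perfrom_eq E xi eta :
  perfrom E xi -> perfrom E eta -> agree (E + p) xi eta -> xi = eta.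
Proof.
move=> pxi peta ag; apply: functional_extensionality => i.
elim/ltn_ind: i => i IHi; case: (ltnP i (E + p)) => [/ag //|le_i].
have Ei : i = i - p + p by lia.
by rewrite Ei pxi ?peta ?IHi //; lia.
Qed.

Lemma perfrom_le E E' xi : E <= E' -> perfrom E xi -> perfrom E' xi.
Proof. by move=> leE per k lek; apply: per; apply: leq_trans lek. Qed.

Lemma perfrom_tail k xi : perfrom 0 xi -> perfrom 0 (tail k xi).
Proof. by move=> per i _; rewrite /tail addnA per. Qed.

Definition sec_perfrom E w xi := forall k, E <= k -> sec w xi (k + p) = sec w xi k.

Lemma perfrom_rw E w xi : perfrom E xi -> sec_perfrom E w xi -> perfrom E (rw w xi).
Proof. by move=> per sper k lek; rewrite !rwE per ?sper. Qed.

Lemma perfrom_shift E k xi : perfrom E (tail k xi) -> perfrom (k + E) xi.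
Proof.
move=> per i lei; have := per (i - k); rewrite /tail addnA subnKC; last by lia.
by apply; lia.
Qed.

Lemma sec_perfrom_shift E k w xi :
  sec_perfrom E (sec w xi k) (tail k xi) -> sec_perfrom (k + E) w xi.
Proof.
move=> per i lei; have := per (i - k); rewrite -!sec_add addnA subnKC; last by lia.
by apply; lia.
Qed.

(* [cyc s]: [s] lies on a cycle, and [Y s] is the periodic ray that follows it. *)
Variables (rk : S -> nat) (K : nat) (cyc : pred S) (Y : S -> nat -> X).
Hypothesis rk_t : forall s x, rk (t s x) <= rk s.
(** [K] will be the number of states: a path this long has repeated a state, and a repeated
    nontrivial state would force positive rank. *)
Hypothesis rk0 : forall s xi k, rk s = 0 -> K <= k ->
  forall x, t (st s xi k) x = st s xi k /\ o (st s xi k) x = x.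
Hypothesis rkK : forall s xi, rk (st s xi K) = rk s -> 0 < rk s -> cyc (st s xi K).
Hypothesis Y_per : forall s, cyc s -> perfrom 0 (Y s).
Hypothesis Y_st : forall s, cyc s -> forall k, st s (Y s) (k + p) = st s (Y s) k.
Hypothesis Y_rk : forall s, cyc s ->
  forall xi k, rk (st s xi k) = rk s <-> agree k xi (Y s).
Hypothesis cyc_st : forall s xi k, cyc s -> rk (st s xi k) = rk s -> cyc (st s xi k).

(* The purely periodic ray may sit anywhere along the trajectory of the word,
   so periodicity is propagated both forwards and backwards. *)
Definition PerB r n E := forall w1 w2 xi,
  size (w1 ++ w2) <= n -> all (fun s => rk s <= r) (w1 ++ w2) ->
  perfrom 0 (rw w1 xi) -> perfrom E xi /\ sec_perfrom E (w1 ++ w2) xi.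

(** Unlike periodicity, a repetition is claimed along every ray, as cutting a long path requires. *)
Definition RepB r n D := forall w xi, size w <= n -> all (fun s => rk s <= r) w ->
  exists k1 k2, [/\ k1 < k2, k2 <= D & sec w xi k1 = sec w xi k2].

Lemma rk_st s xi k : rk (st s xi k) <= rk s.
Proof. by elim: k => //= k; apply: leq_trans; exact: rk_t. Qed.

Lemma sec_const w xi k : all (fun s => rk s <= 0) w -> K <= k ->
  sec w xi k.+1 = sec w xi k /\ rw w xi k = xi k.
Proof.
elim: w xi => //= s w IHw xi /andP[]; rewrite leqn0 => /eqP rs lew leK.
have [ts os] := rk0 (s := s) xi rs leK (xi k).
have [-> e2] := IHw (ro s xi) lew leK.
by rewrite ts /rw /= -/(rw _ _) e2 /ro os.
Qed.

(** From level [K] on, a word of rank 0 copies its input, so [xi] inherits the period of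
    [rw w1 xi]. *)
Lemma PerB0 n : PerB 0 n K.
Proof.
move=> w1 w2 xi _ lew per.
have secc k i : K <= k -> sec (w1 ++ w2) xi (k + i) = sec (w1 ++ w2) xi k.
  move=> leK; elim: i => [|i IHi]; rewrite ?addn0 // addnS.
  by have [-> _] := sec_const xi lew (leq_trans leK (leq_addr i k)).
split=> [k leK|k leK]; last exact: secc.
move: lew; rewrite all_cat => /andP[lew _].
have [_ <-] := sec_const xi lew leK.
by have [_ <-] := sec_const xi lew (leq_trans leK (leq_addr p k)); apply: per.
Qed.

Lemma RepB0 n : RepB 0 n K.+1.
Proof.
move=> w xi _ lew; exists K, K.+1; split=> //.
by have [->] := sec_const xi lew (leqnn K).
Qed.

(** * Induction step: words of rank at most [r + 1] *)

Section Step.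
Variables (r n E0 : nat).
Hypothesis per_r : PerB r n E0.

Let E := E0 + p.
Let act s := rk s == r.+1.
Let cnt w := count act w.
(** Every letter of top rank already lies on its cycle; [good_secK] achieves this in [K] levels. *)
Let good w := all (fun s => (rk s <= r) || (rk s == r.+1) && cyc s) w.

(* The letters of top rank in [w] form one cluster: on every ray they keep
   their rank together or drop together. *)
Definition OneCl w := forall xi k, cnt (sec w xi k) = cnt w \/ cnt (sec w xi k) = 0.

Lemma good_sec w xi k : good w -> good (sec w xi k).
Proof.
elim: w xi => //= s w IHw xi /andP[gs /IHw->]; rewrite andbT.
case/orP: gs => [les|/andP[/eqP es cs]]; first by rewrite (leq_trans (rk_st _ _ _)).
have := rk_st s xi k; rewrite leq_eqVlt es ltnS => /orP[/eqP e|-> //].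
by rewrite e eqxx /= cyc_st ?orbT // e es.
Qed.

Lemma good_secK w xi : all (fun s => rk s <= r.+1) w -> good (sec w xi K).
Proof.
elim: w xi => //= s w IHw xi /andP[les /IHw->]; rewrite andbT.
have := leq_trans (rk_st s xi K) les; rewrite leq_eqVlt ltnS => /orP[/eqP e|-> //].
have es : rk s = r.+1 by have := rk_st s xi K; lia.
by rewrite e eqxx rkK ?orbT // ?e ?es.
Qed.

Lemma cnt_cat w1 w2 : cnt (w1 ++ w2) = cnt w1 + cnt w2.
Proof. exact: count_cat. Qed.

Lemma cnt_split w1 s w2 : cnt (w1 ++ s :: w2) = cnt w1 + (act s + cnt w2).
Proof. by rewrite cnt_cat. Qed.

Lemma cnt_sec_split w1 s w2 xi k : cnt (sec (w1 ++ s :: w2) xi k) =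
  cnt (sec w1 xi k) + (act (st s (rw w1 xi) k) + cnt (sec w2 (ro s (rw w1 xi)) k)).
Proof. by rewrite sec_cat cnt_cat. Qed.

Lemma cnt_sec w xi k : good w -> cnt (sec w xi k) <= cnt w.
Proof.
elim: w xi => //= s w IHw xi /andP[gs gw]; apply: leq_add; last exact: IHw.
have := rk_st s xi k; rewrite /act.
by case/orP: gs => [|/andP[/eqP-> _]]; case: eqP => // ->; lia.
Qed.

Lemma cnt0_rk w : good w -> cnt w = 0 -> all (fun s => rk s <= r) w.
Proof.
elim: w => //= s w IHw /andP[gs gw] /eqP; rewrite addn_eq0 => /andP[ns /eqP/(IHw gw)->].
by move: gs ns; rewrite /act andbT; case: (rk s <= r) => //= /andP[->].
Qed.

Lemma alive_agree s xi k : act s -> cyc s -> act (st s xi k) <-> agree k xi (Y s).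
Proof.
move=> /eqP es cs; rewrite -Y_rk // es /act; split; first by move/eqP.
by move=> ->.
Qed.

Lemma good_cyc w1 s w2 : good (w1 ++ s :: w2) -> act s -> cyc s.
Proof.
rewrite /good all_cat => /and3P[_ /orP[le1|/andP[]//] _] /eqP es.
by move: le1; rewrite es ltnn.
Qed.

Lemma cnt_first w : 0 < cnt w ->
  exists w1 s w2, [/\ w = w1 ++ s :: w2, act s & cnt w1 = 0].
Proof.
elim: w => //= s w IHw; case: (boolP (act s)) => [as_ _|ns] /=.
  by exists [::], s, w.
move=> /IHw[w1 [s' [w2 [-> as' c0]]]]; exists (s :: w1), s', w2; split=> //=.
by rewrite (negbTE ns).
Qed.

Lemma cnt_last w : 0 < cnt w ->
  exists w1 s w2, [/\ w = w1 ++ s :: w2, act s & cnt w2 = 0].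
Proof.
move=> c; have : 0 < cnt (rev w) by rewrite /cnt count_rev.
move=> /cnt_first[w1 [s [w2 [e as_ c0]]]]; exists (rev w2), s, (rev w1); split=> //.
  by rewrite -[w]revK e rev_cat rev_cons -cats1 -catA.
by rewrite /cnt count_rev.
Qed.

(** A full count requires every letter of top rank to survive, and [OneCl] leaves zero as the only
    other count; so [s] decides for its whole cluster. *)
Lemma alive_cnt w1 s w2 xi k : good (w1 ++ s :: w2) -> act s -> OneCl (w1 ++ s :: w2) ->
  cnt (sec (w1 ++ s :: w2) xi k) =
  if act (st s (rw w1 xi) k) then cnt (w1 ++ s :: w2) else 0.
Proof.
move=> gw as_ /(_ xi k); move: (gw); rewrite /good all_cat /= => /and3P[g1 _ g2].
have := cnt_sec xi k g1; have := cnt_sec (ro s (rw w1 xi)) k g2.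
by rewrite sec_cat !cnt_cat /= as_; case: ifP; lia.
Qed.

Lemma OneCl_sec w xi k : good w -> OneCl w -> OneCl (sec w xi k).
Proof.
move=> gw ow eta i; rewrite -sec_glue.
have := ow (glue k xi eta) (k + i); rewrite sec_glue.
have := cnt_sec eta i (good_sec xi k gw); have := cnt_sec xi k gw; lia.
Qed.

Lemma OneCl_small w : good w -> cnt w <= 1 -> OneCl w.
Proof. by move=> gw c xi k; have := cnt_sec xi k gw; lia. Qed.

Lemma OneCl_cat0 w1 w2 : good w1 -> good w2 -> OneCl w1 -> OneCl w2 ->
  cnt w1 = 0 \/ cnt w2 = 0 -> OneCl (w1 ++ w2).
Proof.
move=> g1 g2 o1 o2 c xi k; rewrite sec_cat !cnt_cat.
have := o1 xi k; have := o2 (rw w1 xi) k.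
have := cnt_sec xi k g1; have := cnt_sec (rw w1 xi) k g2; lia.
Qed.

Lemma cyc_out_per s : cyc s -> perfrom 0 (ro s (Y s)).
Proof. by move=> cs k _; rewrite /ro Y_st // Y_per. Qed.

(* Two special letters that survive together for [E0 + p] levels have special
   rays matched exactly by the intermediate word, since both rays are periodic
   from [E0] on; so they survive or die together on every ray. *)
Lemma OneCl_merge w1 w2 xi : good w1 -> good w2 -> size (w1 ++ w2) <= n ->
  OneCl w1 -> OneCl w2 ->
  0 < cnt (sec w1 xi E) -> 0 < cnt (sec w2 (rw w1 xi) E) -> OneCl (w1 ++ w2).
Proof.
move=> g1 g2 sz o1 o2 c1 c2.
(* The top-rank letters on either side of the seam are chosen, so that [b ++ c] between them has
   rank at most [r]. *)
have /cnt_last[a [s [b [e1 as_ b0]]]] := leq_trans c1 (cnt_sec xi E g1).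
have /cnt_first[c [s' [d [e2 as' c0]]]] := leq_trans c2 (cnt_sec (rw w1 xi) E g2).
have cs : cyc s by apply: (@good_cyc a s b); rewrite -?e1.
have cs' : cyc s' by apply: (@good_cyc c s' d); rewrite -?e2.
move: g1 g2 o1 o2 c1 c2 sz; rewrite e1 e2 => {e1 e2 w1 w2} g1 g2 o1 o2.
rewrite !alive_cnt //; case: ifP => // al _; case: ifP => // al' _ sz.
have {}al : agree E (rw a xi) (Y s) by apply/alive_agree.
have {}al' : agree E (rw c (rw (a ++ s :: b) xi)) (Y s') by apply/alive_agree.
have gbc : good (b ++ c).
  by move: g1 g2; rewrite /good !all_cat /= => /and3P[_ _ ->] /andP[->].
have link : rw (b ++ c) (ro s (Y s)) = Y s'.
  have [pz sz'] : perfrom E0 (ro s (Y s)) /\ sec_perfrom E0 (b ++ c) (ro s (Y s)).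
    apply: (@per_r [::] (b ++ c)); last exact: cyc_out_per.
      by move: sz; rewrite /= !size_cat /=; lia.
    by rewrite cat0s; apply: cnt0_rk; rewrite // cnt_cat b0 c0.
  apply: (@perfrom_eq E0); first exact: perfrom_rw.
    by apply: (@perfrom_le 0) => //; exact: Y_per.
  apply: agree_trans al'; apply: agree_sym.
  by move: (rw_agree (b ++ c) (ro_agree s al)); rewrite !rw_cat /=.
move=> eta k; rewrite sec_cat !cnt_cat !alive_cnt //.
have -> : act (st s' (rw c (rw (a ++ s :: b) eta)) k) = act (st s (rw a eta) k).
  apply/idP/idP => al2.
    have ag : agree k (rw c (rw (a ++ s :: b) eta)) (Y s') by apply/alive_agree.
    apply/alive_agree => //; apply: (@agree_ro k s); apply: (@agree_rw k (b ++ c)).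
    by rewrite link; move: ag; rewrite !rw_cat.
  have ag : agree k (rw a eta) (Y s) by apply/alive_agree.
  apply/alive_agree => //.
  by move: (rw_agree (b ++ c) (ro_agree s ag)); rewrite link !rw_cat.
by rewrite -!cnt_cat; case: ifP => _; [left; rewrite !cnt_cat | right].
Qed.

(** Each half becomes a cluster by induction. In one more round of [E] levels, either a half loses
    all its top-rank letters, or both survive and [OneCl_merge] joins them. *)
Lemma OneCl_halving j w xi : good w -> size w <= n -> size w <= 2 ^ j ->
  OneCl (sec w xi (j * E)).
Proof.
elim: j w xi => [|j IHj] w xi gw szn szj.
  rewrite mul0n sec0; apply: OneCl_small => //.
  by apply: leq_trans szj; exact: count_size.
pose w1 := take (2 ^ j) w; pose w2 := drop (2 ^ j) w.
have sz2 : size w2 <= 2 ^ j by rewrite size_drop; move: szj; rewrite expnS; lia.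
have sz1 : size w1 <= 2 ^ j by rewrite size_take; case: ltnP.
have ew : w1 ++ w2 = w by rewrite cat_take_drop.
have szw : size w1 + size w2 = size w by rewrite -size_cat ew.
have [g1 g2] : good w1 /\ good w2.
  by apply/andP; move: gw; rewrite -ew /good all_cat.
have [szn1 szn2] : size w1 <= n /\ size w2 <= n by lia.
rewrite -ew mulSn addnC sec_add sec_cat.
set v1 := sec w1 _ _; set v2 := sec w2 _ _; set eta := tail _ _.
have o1 : OneCl v1 by apply: IHj.
have o2 : OneCl v2 by apply: IHj.
have gv1 : good v1 by apply: good_sec.
have gv2 : good v2 by apply: good_sec.
case: (posnP (cnt (sec v1 eta E))) => [c0|c1].
  by rewrite sec_cat; apply: OneCl_cat0; try exact: good_sec; try exact: OneCl_sec; left.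
case: (posnP (cnt (sec v2 (rw v1 eta) E))) => [c0|c2].
  by rewrite sec_cat; apply: OneCl_cat0; try exact: good_sec; try exact: OneCl_sec; right.
apply: OneCl_sec; first by rewrite /good all_cat; apply/andP.
by apply: (OneCl_merge (xi := eta)); rewrite // size_cat !size_sec szw.
Qed.

Lemma cat_sec_perfrom F w1 w2 xi :
  sec_perfrom F w1 xi -> sec_perfrom F w2 (rw w1 xi) -> sec_perfrom F (w1 ++ w2) xi.
Proof. by move=> p1 p2 k lek; rewrite !sec_cat p1 ?p2. Qed.

(** The first top-rank letter [s] is peeled off. The lower-rank prefix sends [xi] to a ray periodic
    from [E0], which agrees with [Y s] on the window and so equals it; the output of [s] is again
    purely periodic, and the induction continues on [b]. *)
Lemma alive_right w xi : good w -> size w <= n -> perfrom 0 xi ->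
  cnt (sec w xi E) = cnt w -> sec_perfrom E0 w xi.
Proof.
have [m] := ubnP (size w); elim: m w xi => // m IHm w xi szm gw szn per al.
case: (posnP (cnt w)) => [c0|/cnt_first[a [s [b [ew as_ a0]]]]].
  by have [//|] := @per_r [::] w xi szn (cnt0_rk gw c0).
have cs : cyc s by apply: (@good_cyc a s b); rewrite -?ew.
move: al gw szm szn; rewrite ew cnt_sec_split cnt_split as_ => al gw szm szn.
move: (gw); rewrite /good all_cat => /andP[ga /andP[_ gb]].
have ca := cnt_sec xi E ga; have cb := cnt_sec (ro s (rw a xi)) E gb.
move: szm szn; rewrite !size_cat /= => szm szn.
have als : act (st s (rw a xi) E) by move: al; case: (act (st _ _ _)) => //; lia.
have {al} alb : cnt (sec b (ro s (rw a xi)) E) = cnt b by move: al; rewrite als; lia.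
have [pxi pa] : perfrom E0 xi /\ sec_perfrom E0 a xi.
  by apply: (@per_r [::] a); rewrite /= ?cnt0_rk //; lia.
have eY : rw a xi = Y s.
  apply: (@perfrom_eq E0); first exact: perfrom_rw.
    by apply: (@perfrom_le 0) => //; exact: Y_per.
  exact/alive_agree.
apply: cat_sec_perfrom => //; rewrite eY in alb *.
move=> k lek /=; rewrite Y_st // IHm //; [lia|lia|exact: cyc_out_per].
Qed.

(** The mirror image of [alive_right]: the last top-rank letter is peeled off, moving backwards. *)
Lemma alive_left w xi : good w -> size w <= n -> perfrom 0 (rw w xi) ->
  cnt (sec w xi E) = cnt w -> perfrom E0 xi /\ sec_perfrom E0 w xi.
Proof.
have [m] := ubnP (size w); elim: m w xi => // m IHm w xi szm gw szn per al.
case: (posnP (cnt w)) => [c0|/cnt_last[a [s [b [ew as_ b0]]]]].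
  by have := @per_r w [::] xi; rewrite cats0; apply=> //; exact: cnt0_rk.
have cs : cyc s by apply: (@good_cyc a s b); rewrite -?ew.
move: al gw szm szn per; rewrite ew cnt_sec_split cnt_split as_ rw_cat => al gw szm szn per.
move: (gw); rewrite /good all_cat => /andP[ga /andP[_ gb]].
have ca := cnt_sec xi E ga; have cb := cnt_sec (ro s (rw a xi)) E gb.
move: szm szn; rewrite !size_cat /= => szm szn.
have als : act (st s (rw a xi) E) by move: al; case: (act (st _ _ _)) => //; lia.
have {al} ala : cnt (sec a xi E) = cnt a by move: al; rewrite als; lia.
have [pb sb] : perfrom E0 (ro s (rw a xi)) /\ sec_perfrom E0 b (ro s (rw a xi)).
  have := @per_r b [::] (ro s (rw a xi)); rewrite cats0; apply=> //; first lia.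
  exact: cnt0_rk.
have ag : agree E (rw a xi) (Y s) by apply/alive_agree.
(* Periodicity is known only after [s], so outputs are compared; injectivity of [s] then recovers
   the input. *)
have eZ : ro s (rw a xi) = ro s (Y s).
  apply: (@perfrom_eq E0) => //; last exact: ro_agree.
  by apply: (@perfrom_le 0) => //; exact: cyc_out_per.
have eY : rw a xi = Y s.
  apply: functional_extensionality => i.
  by apply: (@agree_ro i.+1 s) => // k _; rewrite eZ.
have [pa sa] : perfrom E0 xi /\ sec_perfrom E0 a xi.
  by apply: IHm; rewrite ?eY //; [lia|lia|exact: Y_per].
split=> //; apply: cat_sec_perfrom => //; rewrite eY in sb *.
by move=> k lek /=; rewrite Y_st // sb.
Qed.

Lemma alive_per w1 w2 xi : good (w1 ++ w2) -> size (w1 ++ w2) <= n ->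
  perfrom 0 (rw w1 xi) -> cnt (sec (w1 ++ w2) xi E) = cnt (w1 ++ w2) ->
  perfrom E0 xi /\ sec_perfrom E0 (w1 ++ w2) xi.
Proof.
rewrite {1}/good all_cat sec_cat !cnt_cat size_cat => /andP[g1 g2] sz per al.
have c1 := cnt_sec xi E g1; have c2 := cnt_sec (rw w1 xi) E g2.
have [pxi s1] : perfrom E0 xi /\ sec_perfrom E0 w1 xi by apply: alive_left => //; lia.
by split=> //; apply: cat_sec_perfrom => //; apply: alive_right => //; lia.
Qed.

(** [K] levels make the word [good], [j * E] more make it one cluster, and [E] more decide its fate.
    If it dies, the rank is at most [r] and another [E0 <= E] levels suffice. *)
Lemma PerB_step j : n <= 2 ^ j -> PerB r.+1 n (K + j.+2 * E).
Proof.
move=> nj w1 w2 xi szn lew per; set k0 := K + j * E.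
suff [pe se] : perfrom (E + E0) (tail k0 xi)
       /\ sec_perfrom (E + E0) (sec (w1 ++ w2) xi k0) (tail k0 xi).
  have leF : k0 + (E + E0) <= K + j.+2 * E by rewrite /k0 /E; lia.
  split; first exact: perfrom_le leF (perfrom_shift pe).
  by move=> k lek; apply: (sec_perfrom_shift se); lia.
have perk : perfrom 0 (rw (sec w1 xi k0) (tail k0 xi)).
  by rewrite rw_tail; exact: perfrom_tail.
have gK := good_secK xi lew.
have ov : OneCl (sec (w1 ++ w2) xi k0).
  by rewrite /k0 sec_add; apply: OneCl_halving => //; rewrite size_sec // (leq_trans szn).
have gv : good (sec (w1 ++ w2) xi k0) by rewrite /k0 sec_add; exact: good_sec.
have szv : size (sec (w1 ++ w2) xi k0) <= n by rewrite size_sec.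
move: ov gv szv; rewrite sec_cat; move: perk.
set v1 := sec w1 _ _; set v2 := sec w2 _ _; set eta := tail _ _ => perk ov gv szv.
case: (ov eta E) => [al|al0].
  have [pe se] := alive_per gv szv perk al.
  split; first by apply: perfrom_le pe; lia.
  by move=> k lek; apply: se; lia.
have ev : sec (v1 ++ v2) eta E = sec v1 eta E ++ sec v2 (rw v1 eta) E by rewrite sec_cat.
have [pe se] : perfrom E0 (tail E eta) /\ sec_perfrom E0 (sec (v1 ++ v2) eta E) (tail E eta).
  rewrite ev; apply: per_r; rewrite -?ev ?size_sec //.
    by apply: cnt0_rk => //; exact: good_sec.
  by rewrite rw_tail; exact: perfrom_tail.
by split; [exact: perfrom_shift | exact: sec_perfrom_shift].
Qed.

Lemma RepB_step j D : n <= 2 ^ j -> RepB r n D -> RepB r.+1 n (K + j.+1 * E + D).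
Proof.
move=> nj rep w xi szn lew; set k0 := K + j * E.
suff [k1 [k2 [lt12 le2 e12]]] : exists k1 k2, [/\ k1 < k2, k2 <= E + D
    & sec (sec w xi k0) (tail k0 xi) k1 = sec (sec w xi k0) (tail k0 xi) k2].
  exists (k0 + k1), (k0 + k2); split; [lia|by rewrite /k0; lia|].
  by rewrite (sec_add _ _ k0 k1) (sec_add _ _ k0 k2).
have gK := good_secK xi lew.
have ov : OneCl (sec w xi k0).
  by rewrite /k0 sec_add; apply: OneCl_halving => //; rewrite size_sec // (leq_trans szn).
have gv : good (sec w xi k0) by rewrite /k0 sec_add; exact: good_sec.
have szv : size (sec w xi k0) <= n by rewrite size_sec.
move: ov gv szv; set v := sec w _ _; set eta := tail _ _ => ov gv szv.
case: (posnP (cnt (sec v eta E))) => [c0|cpos].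
  have [|k1 [k2 [lt12 le2 e12]]] := rep (sec v eta E) (tail E eta) _ (cnt0_rk (good_sec _ _ gv) c0).
    by rewrite size_sec.
  by exists (E + k1), (E + k2); rewrite (sec_add _ _ E k1) (sec_add _ _ E k2); split=> //; lia.
have al : cnt (sec v eta E) = cnt v by have := ov eta E; lia.
have /cnt_first[a [s [b [ev as_ _]]]] : 0 < cnt v by rewrite -al.
have cs : cyc s by apply: (@good_cyc a s b); rewrite -?ev.
have als : act (st s (rw a eta) E).
  move: cpos; rewrite ev alive_cnt -?ev //; by case: ifP.
(* The ray [eta] need not follow the special ray beyond level [E]. A ray [zeta] that does so forever
   is periodic by [alive_per], and it shares with [eta] the [E0 + p] letters needed to see one
   repetition. *)
have [zeta ez] := rw_surj a (Y s).
have ag : agree E zeta eta.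
  apply: (@agree_rw E a); rewrite ez; apply: agree_sym; exact/alive_agree.
have [_ se] : perfrom E0 zeta /\ sec_perfrom E0 (a ++ s :: b) zeta.
  apply: alive_per; rewrite -?ev // ?ez; first exact: Y_per.
  by rewrite (sec_agree v ag).
exists E0, (E0 + p); split; [lia|by rewrite /E; lia|].
rewrite -(sec_agree v (k := E0) (xi := zeta)); last by apply: agree_le ag; rewrite /E; lia.
by rewrite -(sec_agree v (k := E0 + p) (xi := zeta)) // ev se.
Qed.

End Step.

Fixpoint Ebd (j r : nat) : nat := if r is r'.+1 then K + j.+2 * (Ebd j r' + p) else K.

Lemma PerB_all n j r : n <= 2 ^ j -> PerB r n (Ebd j r).
Proof. by move=> nj; elim: r => [|r IHr]; [exact: PerB0 | exact: PerB_step]. Qed.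

(** Adding [K + p] turns the affine recursion into one of ratio at most [j + 3]. *)
Lemma Ebd_le j r : Ebd j r + (K + p) <= j.+3 ^ r * (2 * K + p).
Proof.
elim: r => [|r IHr] /=; first by rewrite expn0; lia.
apply: leq_trans (_ : j.+3 * (Ebd j r + (K + p)) <= _); first by lia.
by rewrite expnS -mulnA leq_mul2l IHr orbT.
Qed.

Lemma RepB_all n j r : n <= 2 ^ j -> RepB r n (j.+3 ^ r * (2 * K + p).+1).
Proof.
move=> nj; elim: r => [|r IHr].
  move=> w xi sz le; have [k1 [k2 [? le2 ?]]] := RepB0 (n := n) xi sz le.
  by exists k1, k2; split=> //; apply: leq_trans le2 _; rewrite expn0; lia.
move=> w xi sz le.
have [k1 [k2 [? le2 ?]]] := RepB_step (@PerB_all n j r nj) nj IHr xi sz le.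
exists k1, k2; split=> //; apply: leq_trans le2 _; rewrite expnS.
(* With [c] the bound at rank [r], the three summands are at most [c], [(j + 1) * c] and [c], in
   total [(j + 3) * c]. *)
have := Ebd_le j r; have : 0 < j.+3 ^ r by rewrite expn_gt0.
move: (j.+3 ^ r) (Ebd j r) => a e a0 le_e.
have : j.+1 * (e + p) <= j.+1 * (a * (2 * K + p)) by apply: leq_mul => //; lia.
have : K <= a * (2 * K + p).+1 by apply: leq_trans (leq_pmull _ a0); lia.
rewrite -mulnA; have : a * (2 * K + p) <= a * (2 * K + p).+1 by rewrite leq_mul.
move: (a * (2 * K + p)) (a * (2 * K + p).+1) => b c l1 l2 l3.
have : j.+1 * b <= j.+1 * c by rewrite leq_mul.
lia.
Qed.

End Rays.

(** * Growth of the number of nontrivial sections *)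

Lemma leq_expn_r m n e : m <= n -> m ^ e <= n ^ e.
Proof. by move=> le_mn; elim: e => // e IHe; rewrite !expnS leq_mul. Qed.

Section Growth.
Import Order.TTheory GRing.Theory Num.Theory.
Variables (X S : finType) (t : S -> X -> S) (o : S -> X -> X).
Variable nt : S -> bool.
Hypothesis ntP : forall s, nt s <-> nontrivial_state t o s.

Lemma trans_cat s u v : trans t s (u ++ v) = trans t (trans t s u) v.
Proof. exact: foldl_cat. Qed.

Lemma nt_up s x : nt (t s x) -> nt s.
Proof. by move=> /ntP[w dw]; apply/ntP; exists (x :: w) => -[_]. Qed.

Lemma nt_trans s u : nt (trans t s u) -> nt s.
Proof. by elim: u s => //= x u IHu s /IHu /nt_up. Qed.

Lemma triv_out s x : ~~ nt s -> o s x = x.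
Proof. by move=> ns; apply: NNPP => dx; case/negP: ns; apply/ntP; exists [:: x] => -[]. Qed.

Lemma triv_outs s w : ~~ nt s -> out t o s w = w.
Proof. by move=> ns; apply: NNPP => dx; case/negP: ns; apply/ntP; exists w. Qed.

Lemma triv_t s x : ~~ nt s -> ~~ nt (t s x).
Proof. exact/contraNN/nt_up. Qed.

Fixpoint growth (s : S) (n : nat) : nat :=
  if n is n'.+1 then \sum_(x : X) growth (t s x) n' else nt s.

Lemma growth_card s n : growth s n = #|[set v : n.-tuple X | nt (trans t s v)]|.
Proof.
suff -> : growth s n = \sum_(v : n.-tuple X) nt (trans t s v).
  by rewrite -sum1dep_card [RHS]big_mkcond; apply: eq_bigr => v _; case: nt.
elim: n s => [|n IHn] s /=.
  by rewrite (big_pred1 [tuple]) // => v; rewrite (tuple0 v) /= eqxx.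
rewrite (reindex (fun u : X * n.-tuple X => [tuple of u.1 :: u.2])) /=; last first.
  exists (fun v : n.+1.-tuple X => (thead v, [tuple of behead v])) => [[x v] _|v _].
    by rewrite theadE; congr pair; apply: val_inj.
  by rewrite [RHS]tuple_eta.
rewrite -(pair_big xpredT xpredT (fun x (v : n.-tuple X) => nat_of_bool (nt (trans t (t s x) v)))) /=.
by apply: eq_bigr => x _; rewrite IHn.
Qed.

Lemma growth_step s x n : growth (t s x) n <= growth s n.+1.
Proof. by rewrite /= (bigD1 x) //= leq_addr. Qed.

Lemma growth_trans s u n : growth (trans t s u) n <= growth s (size u + n).
Proof.
by elim: u s => //= x u IHu s; apply: leq_trans (IHu _) _; exact: growth_step.
Qed.

(** Distinct words of equal length lead to disjoint subtrees. *)
Lemma growth_two s v v' n : size v' = size v -> v' <> v ->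
  growth (trans t s v) n + growth (trans t s v') n <= growth s (size v + n).
Proof.
elim: v v' s => [|x v IHv] [|x' v'] s //= [sz] dv.
have [exx|dx] := eqVneq x' x.
  rewrite exx in dv *; apply: leq_trans (IHv _ _ sz _) (growth_step _ _ _).
  by move=> e; apply: dv; rewrite e.
rewrite (bigD1 x) //= (bigD1 x') //= addnA; apply: leq_trans (leq_addr _ _).
by apply: leq_add; [|rewrite -sz]; exact: growth_trans.
Qed.

(* [lev m s]: from [s] one reaches a chain of [m + 1] nontrivial cycles, each
   left for the next one; [m] is then a lower bound on the degree of [s]. *)
Fixpoint lev (m : nat) (s : S) : Prop :=
  if m is m'.+1 then
    exists u v v', [/\ trans t (trans t s u) v = trans t s u, size v' = size v,
                       v' <> v & lev m' (trans t (trans t s u) v')]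
  else
    exists u v, [/\ nt (trans t s u), v <> [::] & trans t (trans t s u) v = trans t s u].

Lemma lev_up m s x : lev m (t s x) -> lev m s.
Proof.
case: m => [[u [v]]|m [u [v [v']]]] h; first by exists (x :: u), v.
by exists (x :: u), v, v'.
Qed.

Lemma lev_trans m s u : lev m (trans t s u) -> lev m s.
Proof. by elim: u s => //= x u IHu s /IHu /lev_up. Qed.

(** If the path to the first cycle is empty, the step goes along that cycle, and the rest of the
    cycle becomes the new path. *)
Lemma lev_step m s : lev m s -> exists x, lev m (t s x).
Proof.
case: m => [[[|x u] [[|y v]]]|m [[|x u] [[|y v] [v']]]] [] //=; last 1 first.
- by move=> e1 e2 n1 l1; exists x, u, (y :: v), v'.
- by move=> n1 _ e1; exists y, v, (y :: v); rewrite e1.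
- by exists x, u, (y :: v).
- by move=> _ /size0nil.
- by move=> e1 e2 n1 l1; exists y, v, (y :: v), v'; rewrite e1.
by move=> _ /size0nil.
Qed.

Lemma lev_pad m s k : lev m s -> exists u, size u = k /\ lev m (trans t s u).
Proof.
elim: k s => [|k IHk] s ls; first by exists [::].
by have [x /IHk[u [<- lu]]] := lev_step ls; exists (x :: u).
Qed.

Lemma lev_nt m s : lev m s -> nt s.
Proof.
elim: m s => [|m IHm] s /=; first by case=> u [v [/nt_trans]].
by case=> u [v [v' [_ _ _ /IHm /nt_trans /nt_trans]]].
Qed.

Lemma lev_down m s : lev m.+1 s -> lev m s.
Proof.
elim: m s => [|m IHm] s [u [v [v' [e1 e2 n1 l1]]]]; last first.
  by exists u, v, v'; split=> //; exact: IHm.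
exists u, v; split=> //; first exact: nt_trans (@lev_nt 0 _ l1).
by move=> v0; rewrite v0 in e2 n1; move/size0nil: e2.
Qed.

Lemma growth_loop q v n k : trans t q v = q -> growth q n <= growth q (size v * k + n).
Proof.
move=> e1; elim: k => [|k IHk]; first by rewrite muln0.
rewrite mulnS -addnA; apply: leq_trans (growth_trans _ _ _); rewrite e1; exact: IHk.
Qed.

(** Pascal's rule: from the first cycle a word either makes another turn or leaves along [v'], and
    [growth_two] adds up the two counts. *)
Lemma growth_lev m s : lev m s ->
  exists a b, 0 < a /\ forall N, 'C(N, m) <= growth s (b + a * N).
Proof.
elim: m s => [|m IHm] s.
  move=> [u [v [n1 v0 e1]]]; exists (size v), (size u); split; first by case: v v0 {e1}.
  move=> N; rewrite bin0; apply: leq_trans (growth_trans _ _ _).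
  apply: leq_trans (_ : growth (trans t s u) 0 <= _); first by rewrite /= n1.
  by have := growth_loop 0 N e1; rewrite addn0.
move=> [u [v [v' [e1 e2 n1 /IHm[a [b [a0 low]]]]]]].
have c0 : 0 < size v.
  by rewrite lt0n; apply/eqP => v0; apply: n1; rewrite (size0nil v0) (size0nil (etrans e2 v0)).
exists (a * size v), (size u + (b + size v)); split; first by rewrite muln_gt0 a0.
move=> N; rewrite -addnA; apply: leq_trans (growth_trans _ _ _).
elim: N => [//|N IHN]; rewrite binS.
set q := trans t s u in e1 low IHN *; set c := size v in e2 c0 low IHN *.
apply: leq_trans (_ : growth q (b + c + a * c * N) + growth (trans t q v') (b + a * (c * N.+1)) <= _).
  apply: leq_add => //; apply: leq_trans (low _); apply: leq_bin2l; nia.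
have -> : b + c + a * c * N.+1 = c + (b + a * (c * N.+1)) by lia.
apply: leq_trans (growth_two _ _ e2 n1); rewrite leq_add2r e1.
have -> : b + a * (c * N.+1) = c * (a.-1) + (b + c + a * c * N) by nia.
exact: growth_loop.
Qed.

Variable d : nat.

Lemma poly_growth : poly_bounded t o d -> exists C, forall s n, growth s n <= C * n.+1 ^ d.
Proof.
case=> P [szP bnd]; pose c : rat := (\sum_(i < size P) `|P`_i|)%R.
exists (Num.bound c) => s n; rewrite growth_card.
rewrite -(ler_nat rat) natrM natrX.
apply: le_trans (bnd s n _ _) _ => [v|]; first by rewrite inE => /ntP.
apply: le_trans (_ : c * n.+1%:R ^+ d <= _)%R; last first.
  apply: ler_wpM2r; first by rewrite exprn_ge0.
  by apply/ltW/archi_boundP; apply: sumr_ge0.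
rewrite horner_coef mulr_suml; apply: ler_sum => i _.
apply: le_trans (ler_norm _) _; rewrite normrM; apply: ler_wpM2l => //.
rewrite ger0_norm ?exprn_ge0 // -!natrX ler_nat.
have lei : i <= d by have := ltn_ord i; lia.
by apply: leq_trans (leq_pexp2l (ltn0Sn n) lei); apply: leq_expn_r.
Qed.

Lemma bin_not_poly a b C : ~ (forall N, 'C(N, d.+1) <= C * (b + a * N).+1 ^ d).
Proof.
(* The constant makes the assumed bound at [N = M + d], multiplied by the factorial of [d + 1],
   imply [M ^ (d + 1) <= c * M ^ d], which fails for [M = c + 1]. *)
move=> h; pose c := C * ((b + a).+1 * d.+2) ^ d * d.+1`!.
pose M := c.+1; have := h (M + d).
rewrite -(@leq_pmul2r (d.+1)`!) ?fact_gt0 // bin_ffact => h1.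
have h2 : M ^ d.+1 <= (M + d) ^_ d.+1.
  rewrite ffact_prod -{1}(card_ord d.+1) -prod_nat_const; apply: leq_prod => i _.
  by have := ltn_ord i; lia.
have h3 : (b + a * (M + d)).+1 <= (b + a).+1 * d.+2 * M by rewrite /M; nia.
have M0 : 0 < M by []; have ltM : c < M by [].
clearbody M; have : M ^ d.+1 <= c * M ^ d.
  apply: leq_trans h2 (leq_trans h1 _).
  have := leq_expn_r d h3; rewrite expnMn /c => h4.
  by rewrite (mulnAC _ _ (M ^ d)) leq_mul2r -mulnA leq_mul2l h4 !orbT.
by rewrite expnS leq_pmul2r ?expn_gt0 ?M0 // leqNgt ltM.
Qed.

Lemma lev_bound s : poly_bounded t o d -> ~ lev d.+1 s.
Proof.
move=> /poly_growth[C bnd] /growth_lev[a [b [_ low]]].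
apply: (@bin_not_poly a b C) => N; exact: leq_trans (low N) (bnd _ _).
Qed.

(** The rank is the largest number of nontrivial cycles in a chain from [s]; it exists because [lev]
    is downward closed and bounded by [lev_bound]. *)
Lemma rank_exists s : poly_bounded t o d ->
  exists r, r <= d.+1 /\ forall m, lev m s <-> m < r.
Proof.
move=> /(@lev_bound s); elim: d => [|e IHe] nl.
  case: (classic (lev 0 s)) => [l0|n0]; [exists 1|exists 0]; split=> // m.
    split; last by case: m.
    by case: m => // m; elim: m => // m IHm /lev_down /IHm.
  by split=> // ; elim: m => // m IHm /lev_down /IHm.
case: (classic (lev e.+1 s)) => [l1|/IHe[r [le_r rP]]]; last first.
  by exists r; split=> //; exact: leqW.
exists e.+2; split=> // m; split=> [lm|lt_m].
  rewrite ltnNge; apply/negP => le_m; apply: nl; move: le_m lm.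
  by move=> /subnK <-; elim: (m - _) => // k IHk /lev_down.
move: lt_m l1; rewrite ltnS => /subnK <-.
by elim: (e.+1 - m) => // k IHk /lev_down.
Qed.

End Growth.

(** * Detection depth of polynomial automata *)

Section Detection.
Variables (X S : finType) (t : S -> X -> S) (o : S -> X -> X).
Hypotheses (o_inj : invertible o) (S_min : minimal t o).
Variable nt : S -> bool.
Hypothesis ntP : forall s, nt s <-> nontrivial_state t o s.

(** By minimality a trivial state equals its successors, which are trivial too. *)
Lemma triv_fix s x : ~~ nt s -> t s x = s.
Proof.
move=> ns; apply: S_min => w.
by rewrite (triv_outs ntP) ?(triv_outs ntP) //; exact: (triv_t ntP).
Qed.

Lemma st_trans s xi k : st t s xi k = trans t s (mkseq xi k).
Proof. by elim: k => // k IHk; rewrite mkseqS /trans foldl_rcons -/(trans t s _) -IHk. Qed.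

Lemma st_pigeon s xi : exists i j, [/\ i < j, j <= #|S| & st t s xi i = st t s xi j].
Proof.
have /injectivePn[i [j dij eij]] : ~~ injectiveb (fun i : 'I_#|S|.+1 => st t s xi i).
  apply/negP => /injectiveP /leq_card; by rewrite card_ord ltnn.
move: dij; rewrite -val_eqE /= neq_ltn => /orP[]lt.
  by exists i, j; split=> //; rewrite -ltnS.
by exists j, i; split=> //; rewrite -ltnS.
Qed.

Lemma st_triv s xi i k : i <= k -> ~~ nt (st t s xi i) -> ~~ nt (st t s xi k).
Proof.
move/subnK <-; elim: (k - i) => // m IHm ns.
exact: (triv_t ntP (xi (m + i)) (IHm ns)).
Qed.

Variables (x0 : X) (d : nat).

(** The ray [v v v ...]; for nonempty [v] the default [x0] is not read. *)
Definition loop_ray (v : seq X) (k : nat) : X := nth x0 v (k %% size v).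

Lemma loop_ray_add v k a : loop_ray v (k + a * size v) = loop_ray v k.
Proof. by rewrite /loop_ray addnC modnMDl. Qed.

Lemma st_loop q v a : trans t q v = q -> st t q (loop_ray v) (a * size v) = q.
Proof.
move=> e; elim: a => // a IHa; rewrite mulSnr st_add IHa.
have -> : tail (a * size v) (loop_ray v) = loop_ray v.
  by apply: functional_extensionality => i; rewrite /tail addnC loop_ray_add.
rewrite st_trans; suff -> : mkseq (loop_ray v) (size v) = v by [].
apply: (@eq_from_nth _ x0) => [|i]; rewrite size_mkseq // => lti.
by rewrite nth_mkseq // /loop_ray modn_small.
Qed.

Lemma st_loop_add q v a k : trans t q v = q ->
  st t q (loop_ray v) (k + a * size v) = st t q (loop_ray v) k.
Proof.
move=> e; rewrite addnC st_add st_loop //; congr (st t q _ k).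
by apply: functional_extensionality => i; rewrite /tail addnC loop_ray_add.
Qed.

(** The path leaving the loop is padded to the length of [k] turns, so that both are words of equal
    length from [q]; this prepends one cycle to the chain. *)
Lemma lev_off m q v xi k : v <> [::] -> trans t q v = q ->
  lev t nt m (st t q xi k) -> ~ agree k xi (loop_ray v) -> lev t nt m.+1 q.
Proof.
move=> v0 e lz nag; have sv : 0 < size v by case: v v0 {e nag}.
have le_k : k <= k * size v by rewrite leq_pmulr.
have [u [szu lu]] := lev_pad (k * size v - k) lz.
exists [::], (mkseq (loop_ray v) (k * size v)), (mkseq xi k ++ u); split=> /=.
- by rewrite -st_trans st_loop.
- by rewrite size_cat !size_mkseq szu subnKC.
- move=> e'; apply: nag => i lti.
  have := congr1 (fun l => nth x0 l i) e'.
  by rewrite nth_cat size_mkseq lti !nth_mkseq // (leq_trans lti).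
by rewrite trans_cat -st_trans.
Qed.

Hypothesis S_poly : poly_bounded t o d.

Lemma section_repeat : exists B, forall w j xi, size w <= 2 ^ j ->
  exists k1 k2, [/\ k1 < k2, k2 <= j.+3 ^ d.+1 * B & sec t o w xi k1 = sec t o w xi k2].
Proof.
have /fin_all_exists[rk rkP] : forall s, exists r, r <= d.+1 /\ forall m, lev t nt m s <-> m < r.
  by move=> s; exact: rank_exists.
have /fin_all_exists[lp lpP] : forall s, exists v, (exists v', v' <> [::] /\ trans t s v' = s) ->
    v <> [::] /\ trans t s v = s.
  move=> s; case: (classic (exists v', v' <> [::] /\ trans t s v' = s)) => [[v' h]|n].
    by exists v'.
  by exists [::].
pose cyc : pred S := fun s => [&& nt s, lp s != [::] & trans t s (lp s) == s].
have cycI s v : nt s -> v <> [::] -> trans t s v = s -> cyc s.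
  move=> ns v0 e; have [/eqP l0 /eqP e'] := lpP s (ex_intro _ v (conj v0 e)).
  by rewrite /cyc ns l0 e'.
pose Y s := loop_ray (lp s).
(* A product, so that every chosen loop length divides it; [maxn 1] keeps it positive at states
   without a loop. *)
pose p := \prod_(s : S) maxn 1 (size (lp s)).
have p_gt0 : 0 < p by apply: prodn_gt0 => s; rewrite leq_max.
have p_mul s : cyc s -> exists a, p = a * size (lp s).
  move=> /and3P[_ l0 _]; exists (\prod_(i | i != s) maxn 1 (size (lp i))).
  rewrite /p (bigD1 s) //= mulnC (maxn_idPr _) //.
  by rewrite lt0n size_eq0.
have rk_trans s u : rk (trans t s u) <= rk s.
  rewrite leqNgt; apply/negP => /(proj2 (proj2 (rkP _) _)) /lev_trans.
  by move=> /(proj1 (proj2 (rkP _) _)); rewrite ltnn.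
have rk_t s x : rk (t s x) <= rk s := rk_trans s [:: x].
have rk_pos s : nt s -> cyc s -> 0 < rk s.
  move=> ns /and3P[_ /eqP l0 /eqP e]; apply/(proj2 (rkP s)).
  by exists [::], (lp s).
have Y_loop s : cyc s -> trans t s (lp s) = s by move=> /and3P[_ _ /eqP].
have Y_per s : cyc s -> perfrom p 0 (Y s).
  by move=> /p_mul[a ->] k _; rewrite /Y loop_ray_add.
have Y_st s : cyc s -> forall k, st t s (Y s) (k + p) = st t s (Y s) k.
  by move=> cs k; have [a ->] := p_mul s cs; rewrite st_loop_add // Y_loop.
have Y_back s k : cyc s -> exists u, trans t (st t s (Y s) k) u = s.
  move=> cs; have /and3P[_ l0 _] := cs.
  have le_k : k <= k * size (lp s) by rewrite leq_pmulr // lt0n size_eq0.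
  exists (mkseq (tail k (Y s)) (k * size (lp s) - k)).
  by rewrite -st_trans -st_add subnKC // st_loop // Y_loop.
(* Leaving the loop without losing rank would lengthen the chain by one cycle; along the loop one
   can return to [s], so the rank cannot drop. *)
have Y_rk s : cyc s -> forall xi k, rk (st t s xi k) = rk s <-> agree k xi (Y s).
  move=> cs xi k; have /and3P[ns /eqP l0 _] := cs; split=> [erk|/st_agree->].
    apply: NNPP => nag; have := rk_pos s ns cs; case er: (rk s) => [//|m] _.
    have lm : lev t nt m (st t s xi k) by apply/(proj2 (rkP _)); rewrite erk er.
    have := lev_off l0 (Y_loop s cs) lm nag.
    by move/(proj2 (rkP s)); rewrite er ltnn.
  apply/eqP; rewrite eqn_leq {1}st_trans rk_trans /=.
  by have [u eu] := Y_back s k cs; rewrite -{1}eu rk_trans.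
have cyc_st s xi k : cyc s -> rk (st t s xi k) = rk s -> cyc (st t s xi k).
  move=> cs /(Y_rk _ cs)/st_agree ->; have /and3P[ns /eqP l0 _] := cs.
  apply: (cycI _ (mkseq (tail k (Y s)) (size (lp s)))).
  - by have [u eu] := Y_back s k cs; apply: (nt_trans ntP (u := u)); rewrite eu.
  - by move=> /(congr1 size); rewrite size_mkseq => /size0nil.
  by rewrite -st_trans -st_add -[size _]mul1n st_loop_add // Y_loop.
have pig s xi : exists i, i <= #|S| /\ exists v, v <> [::] /\ trans t (st t s xi i) v = st t s xi i.
  have [i [j [ltij lej e]]] := st_pigeon s xi; exists i; split; first by lia.
  exists (mkseq (tail i xi) (j - i)); split.
    by move=> /(congr1 size); rewrite size_mkseq /=; lia.
  by rewrite -st_trans -st_add subnKC // ltnW.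
have rk0 s xi k : rk s = 0 -> #|S| <= k ->
    forall x, t (st t s xi k) x = st t s xi k /\ o (st t s xi k) x = x.
  move=> r0 lek x; suff ns : ~~ nt (st t s xi k).
    by split; [exact: triv_fix | exact: (triv_out ntP)].
  have [i [lei [v [v0 e]]]] := pig s xi.
  apply: st_triv (leq_trans lei lek) _; apply/negP => ni.
  have : lev t nt 0 s by exists (mkseq xi i), v; rewrite -st_trans.
  by move/(proj2 (rkP s)); rewrite r0.
(* Within [#|S|] levels the path meets a state on a cycle. Its rank is still positive, so it is
   nontrivial, and [cyc_st] carries the property down to level [#|S|]. *)
have rkK s xi : rk (st t s xi #|S|) = rk s -> 0 < rk s -> cyc (st t s xi #|S|).
  move=> er rpos; have [i [lei [v [v0 e]]]] := pig s xi.
  have eK : st t s xi #|S| = st t (st t s xi i) (tail i xi) (#|S| - i).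
    by rewrite -st_add subnKC.
  have er' : rk (st t s xi i) = rk s.
    apply/eqP; rewrite eqn_leq {1}st_trans rk_trans /= -er eK.
    by rewrite [X in rk X <= _]st_trans rk_trans.
  rewrite eK; apply: cyc_st; last by rewrite -eK er er'.
  apply: cycI e => //; apply: (@lev_nt _ _ t o nt ntP 0).
  by apply/(proj2 (rkP _)); rewrite er'.
exists (2 * #|S| + p).+1 => w j xi szw.
have h := RepB_all o_inj p_gt0 rk_t rk0 rkK Y_per Y_st Y_rk cyc_st (r := d.+1) (leqnn _).
apply: (h j) => //; apply/allP => s _; by have [] := rkP s.
Qed.

Lemma size_out s u : size (out t o s u) = size u.
Proof. by elim: u s => //= x u IHu s; rewrite IHu. Qed.

Lemma size_act_word w u : size (act_word t o w u) = size u.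
Proof. by elim: w u => //= s w IHw u; rewrite /act_word /= -/(act_word _ _ _ _) IHw size_out. Qed.

Lemma act_cons w x v :
  act_word t o w (x :: v) = olet o w x :: act_word t o (section_word t o w x) v.
Proof.
rewrite /act_word /olet; elim: w x v => //= s w IHw x v; exact: IHw.
Qed.

Lemma act_sec w xi k v :
  act_word t o w (mkseq xi k ++ v)
  = act_word t o w (mkseq xi k) ++ act_word t o (sec t o w xi k) v.
Proof.
have act0 w' : act_word t o w' [::] = [::] by apply: size0nil; rewrite size_act_word.
elim: k v => [|k IHk] v; first by rewrite sec0 [mkseq xi 0]/= act0.
by rewrite mkseqS -cats1 -catA IHk [in RHS]IHk secS !act_cons act0 -catA.
Qed.

(** Induction on the length of [v]: the stretch between two levels with equal sections is cut out.
    Both prefixes are short enough to be fixed by assumption, so [w] fixes [v] if it fixes the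
    shortened word. *)
Lemma detect_depth : exists B, forall w j, size w <= 2 ^ j ->
  (forall v, size v <= j.+3 ^ d.+1 * B -> act_word t o w v = v) -> WP t o w.
Proof.
have [B rep] := section_repeat; exists B => w j szw triv v.
have [n] := ubnP (size v); elim: n v => // n IHn v szv.
case: (leqP (size v) (j.+3 ^ d.+1 * B)) => [/triv //|ltv].
pose xi := nth x0 v.
have [k1 [k2 [lt12 le2 e12]]] := rep w j xi szw.
have cut k : k <= size v -> v = mkseq xi k ++ drop k v.
  move=> lek; rewrite -{1}(cat_take_drop k v); congr (_ ++ _).
  apply: (@eq_from_nth _ x0); rewrite size_takel ?size_mkseq // => i lti.
  by rewrite nth_take // nth_mkseq.
have fix1 : act_word t o (sec t o w xi k1) (drop k2 v) = drop k2 v.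
  have := IHn (mkseq xi k1 ++ drop k2 v).
  rewrite act_sec triv ?size_mkseq; last by lia.
  rewrite size_cat size_mkseq size_drop => /(_ ltac:(lia)) /eqP.
  by rewrite eqseq_cat // eqxx => /eqP.
have e2 := cut k2 ltac:(lia).
by rewrite e2 act_sec triv -?e12 ?fix1 // size_mkseq.
Qed.

End Detection.

(** * Detection depth of contracting automata *)

Section Contraction.
Variables (X S : finType) (t : S -> X -> S) (o : S -> X -> X).

Lemma size_section w x : size (section_word t o w x) = size w.
Proof. by elim: w x => //= s w IHw x; rewrite IHw. Qed.

Lemma section_cat w1 w2 x :
  section_word t o (w1 ++ w2) x = section_word t o w1 x ++ section_word t o w2 (olet o w1 x).
Proof. by elim: w1 x => //= s w1 IHw x; rewrite IHw. Qed.

Lemma act_cat w1 w2 v : act_word t o (w1 ++ w2) v = act_word t o w2 (act_word t o w1 v).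
Proof. exact: foldl_cat. Qed.

Lemma section_ext w w' x : act_word t o w =1 act_word t o w' ->
  act_word t o (section_word t o w x) =1 act_word t o (section_word t o w' x).
Proof. by move=> e v; have := e (x :: v); rewrite !act_cons => -[]. Qed.

(** The word is cut into blocks of length [N], and the section of each block can be replaced by a
    strictly shorter word. *)
Lemma contract_letter : contracting t o -> exists N, 0 < N /\ forall w x, exists w',
  act_word t o w' =1 act_word t o (section_word t o w x) /\ size w' <= size w - size w %/ N.
Proof.
case=> N0 ctr; pose N := maxn 1 N0; have N0_gt0 : 0 < N by rewrite leq_max.
exists N; split=> // w x.
have [n] := ubnP (size w); elim: n w x => // n IHn w x szw.
case: (ltnP (size w) N) => [lt_w|le_w].
  by exists (section_word t o w x); rewrite size_section divn_small // subn0.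
pose a := take N w; pose b := drop N w.
have sza : size a = N by rewrite size_takel.
have szb : size b = size w - N by rewrite size_drop.
have [a' [ea sa]] := ctr a (leq_trans (leq_maxr 1 N0) (eq_leq (esym sza))) x.
have [b' [eb sb]] : exists w', act_word t o w' =1
    act_word t o (section_word t o b (olet o a x)) /\ size w' <= size b - size b %/ N.
  by apply: IHn; rewrite szb; lia.
exists (a' ++ b'); split=> [v|].
  by rewrite act_cat ea eb -(cat_take_drop N w) section_cat act_cat.
have -> : size w = N + size b by lia.
rewrite size_cat divnDl // divnn N0_gt0.
have := leq_div (size b) N; lia.
Qed.

Lemma sec_contract w w' xi k N :
  (forall w x, exists w', act_word t o w' =1 act_word t o (section_word t o w x)
     /\ size w' <= size w - size w %/ N) ->
  act_word t o w' =1 act_word t o (sec t o w xi k) -> exists w'',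
  act_word t o w'' =1 act_word t o (sec t o w xi k.+1) /\ size w'' <= size w' - size w' %/ N.
Proof.
move=> ctr e; have [w'' [e'' s'']] := ctr w' (xi k).
by exists w''; split=> // v; rewrite secS e''; exact: section_ext.
Qed.

(** While the length exceeds [M * N], each level removes at least [M] letters; hence [N] levels
    bring it from [2 * M * N] down to [M * N]. *)
Lemma contract_halving w xi N j : 0 < N ->
  (forall w x, exists w', act_word t o w' =1 act_word t o (section_word t o w x)
     /\ size w' <= size w - size w %/ N) ->
  size w <= 2 ^ j * N -> exists w',
  act_word t o w' =1 act_word t o (sec t o w xi (j * N)) /\ size w' <= N.
Proof.
move=> N_gt0 ctr szw.
suff h i : i <= j -> exists w', act_word t o w' =1 act_word t o (sec t o w xi (i * N))
    /\ size w' <= 2 ^ (j - i) * N.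
  by have := h j (leqnn j); rewrite subnn mul1n.
elim: i => [_|i IHi lt_ij]; first by exists w; rewrite sec0 subn0.
have [v [ev sv]] := IHi (ltnW lt_ij).
move: sv; have -> : j - i = (j - i.+1).+1 by lia.
rewrite expnS; set M := 2 ^ (j - i.+1) => sv.
have step l : l <= N -> exists w', act_word t o w' =1 act_word t o (sec t o w xi (i * N + l))
    /\ size w' <= maxn (M * N) (2 * M * N - l * M).
  elim: l => [_|l IHl lt_l]; first by exists v; rewrite addn0 mul0n subn0 leq_max sv orbT.
  have [u [eu su]] := IHl (ltnW lt_l); have [u' [eu' su']] := sec_contract ctr eu.
  exists u'; rewrite addnS; split=> //.
  have [le_u|lt_u] := leqP (size u) (M * N).
    by rewrite leq_max (leq_trans su' (leq_trans (leq_subr _ _) le_u)).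
  have : M <= size u %/ N by rewrite leq_divRL // ltnW.
  move: su; rewrite leq_max leqNgt lt_u /= => su le_M.
  rewrite leq_max; apply/orP; right; apply: leq_trans su' _.
  by apply: leq_trans (leq_sub su le_M) _; rewrite (mulSnr l) subnDA.
have [u [eu su]] := step N (leqnn N).
by exists u; rewrite mulSnr; split=> //; move: su; rewrite -mulnA (mulnC N); lia.
Qed.

(** After [j * N] levels every section acts as a word of length at most [N], and since [N <= 2 ^ N],
    [detect_depth] with [N] in place of [j] tests that word at constant depth. *)
Lemma contracting_depth (nt : S -> bool) (x0 : X) (d : nat) :
  invertible o -> minimal t o -> (forall s, nt s <-> nontrivial_state t o s) ->
  poly_bounded t o d -> contracting t o -> exists B, forall w j, size w <= 2 ^ j ->
  (forall v, size v <= j.+3 * B -> act_word t o w v = v) -> WP t o w.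
Proof.
move=> o_inj S_min ntP S_poly /contract_letter[N [N_gt0 ctr]].
have [B det] := detect_depth o_inj S_min ntP x0 S_poly.
pose B' := N.+3 ^ d.+1 * B; exists (N + B') => w j szw triv v.
have le_d : j * N + B' <= j.+3 * (N + B') by rewrite mulnDr; apply: leq_add; lia.
pose k := j * N; pose xi := nth x0 v.
have [w' [ew' sw']] : exists w', act_word t o w' =1 act_word t o (sec t o w xi k) /\ size w' <= N.
  by apply: contract_halving => //; apply: leq_trans szw _; rewrite leq_pmulr.
have wp : WP t o w'.
  apply: (det w' N) => [|u szu]; first by rewrite (leq_trans sw') // ltnW // ltn_expl.
  have := triv (mkseq xi k ++ u); rewrite act_sec triv ?size_cat ?size_mkseq; [|lia..].
  move=> /(_ ltac:(lia)) /eqP; rewrite eqseq_cat // eqxx /= => /eqP e.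
  by rewrite ew'.
have [le_v|lt_v] := leqP (size v) k; first by apply: triv; lia.
have -> : v = mkseq xi k ++ drop k v.
  rewrite -{1}(cat_take_drop k v); congr (_ ++ _).
  apply: (@eq_from_nth _ x0); rewrite size_takel ?size_mkseq ?(ltnW lt_v) // => i lti.
  by rewrite nth_take // nth_mkseq.
by rewrite act_sec -ew' wp triv // size_mkseq; lia.
Qed.

End Contraction.

(** * Stack machines *)

Definition reads (Sigma : finType) (M : TM Sigma) (c : config M) :=
  [ffun i => c_tape c i (c_head c i)].

Lemma tm_stepE (Sigma : finType) (M : TM Sigma) (c : config M) :
  ~~ tm_halt M (c_state c) ->
  let d := tm_delta M (c_state c) (reads c) in
  [/\ c_state (tm_step c) = d.1.1,
     forall j, c_head (tm_step c) j = (c_head c j + Posz (d.2 j : nat) - 1)%R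
   & forall j p, c_tape (tm_step c) j p =
       if p == c_head c j then d.1.2 j else c_tape c j p].
Proof.
by rewrite /tm_step => /negbTE->; rewrite -/(reads c); case: (tm_delta _ _ _) => [[]].
Qed.

Section StackMachine.
Variables (Sigma Q I G : finType) (inp : Sigma -> G).
Hypothesis inp_inj : injective inp.
Variables (q0 : Q) (halt acc : pred Q) (psel : Q -> option I).
Variable nxt : Q -> option G -> Q * (option I -> option G).

Definition stacks := option I -> seq G.

(* Stack [None] initially holds the input, with its last letter on top; what
   [nxt] pushes on the popped stack is ignored. *)
Definition sm_step (c : Q * stacks) : Q * stacks :=
  if halt c.1 then c else
  let r := nxt c.1 (ohead (c.2 (psel c.1))) in
  (r.1, fun i => if i == psel c.1 then behead (c.2 i)
                 else if r.2 i is Some g then g :: c.2 i else c.2 i).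

Definition sm_init (w : seq Sigma) : Q * stacks :=
  (q0, fun i => if i is None then rev (map inp w) else [::]).

Definition sm_run n w := iter n sm_step (sm_init w).

Definition tape_of (i : option I) : 'I_(#|I|.+1) :=
  if i is Some i' then lift ord0 (enum_rank i') else ord0.

Definition stack_of (j : 'I_(#|I|.+1)) : option I := omap enum_val (unlift ord0 j).

Lemma tape_ofK : cancel tape_of stack_of.
Proof. by case=> [i|]; rewrite /stack_of /= ?liftK ?unlift_none //= enum_rankK. Qed.

Lemma stack_ofK : cancel stack_of tape_of.
Proof. by move=> j; rewrite /stack_of; case: unliftP => [i ->|->] //=; rewrite enum_valK. Qed.

Lemma eq_tape_of i j : (j == tape_of i) = (stack_of j == i).
Proof. by rewrite -(can_eq stack_ofK) tape_ofK. Qed.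

Definition mv_left : 'I_3 := ord0.
Definition mv_stay : 'I_3 := inord 1.
Definition mv_right : 'I_3 := ord_max.

(* State [None] scans the input to its right end; [Some (q, false)] moves the
   head of the popped stack onto its top symbol, [Some (q, true)] acts on it. *)
Definition sim_delta (s : option (Q * bool)) (r : {ffun 'I_(#|I|.+1) -> option G}) :
  option (Q * bool) * {ffun 'I_(#|I|.+1) -> option G} * {ffun 'I_(#|I|.+1) -> 'I_3} :=
  match s with
  | None =>
    if r ord0 is Some _ then (None, r, [ffun j => if j == ord0 then mv_right else mv_stay])
    else (Some (q0, false), r, [ffun j => mv_stay])
  | Some (q, false) =>
    (Some (q, true), r, [ffun j => if stack_of j == psel q then mv_left else mv_stay])
  | Some (q, true) =>
    let g := r (tape_of (psel q)) in
    let n := nxt q g in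
    (Some (n.1, false),
     [ffun j => if stack_of j == psel q then None
                else if n.2 (stack_of j) is Some g' then Some g' else r j],
     [ffun j => if stack_of j == psel q then (if g is None then mv_right else mv_stay)
                else if n.2 (stack_of j) is Some _ then mv_right else mv_stay])
  end.

Definition sim_halt (s : option (Q * bool)) := if s is Some (q, false) then halt q else false.
Definition sim_acc (s : option (Q * bool)) := if s is Some (q, false) then acc q else false.

Lemma Some_inp_inj : injective (fun a => Some (inp a)).
Proof. by move=> a b [] /inp_inj. Qed.

Lemma Some_inp_new a : Some (inp a) <> None.
Proof. by []. Qed.

Definition sim : TM Sigma :=
  @MkTM Sigma #|I| (option (Q * bool)) (option G) None (fun a => Some (inp a))
    Some_inp_inj Some_inp_new
    None sim_halt sim_acc sim_delta.


Definition tape_cells (l : seq G) (p : int) : option G :=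
  if p is Posz m then onth (rev l) m else None.

Lemma tape_cells_cons g l p :
  tape_cells (g :: l) p = if p == Posz (size l) then Some g else tape_cells l p.
Proof.
case: p => //= m; rewrite rev_cons -cats1 onth_cat size_rev eqz_nat.
case: ltngtP => // [lt|->]; last by rewrite subnn.
by rewrite [LHS]onth_default ?subn_gt0 // onth_default // size_rev ltnW.
Qed.

Lemma tape_cells_out l : tape_cells l (size l) = None.
Proof. by rewrite /= onth_default // size_rev. Qed.

Lemma tape_cells_top l : tape_cells l (Posz (size l) - 1)%R = ohead l.
Proof.
case: l => // g l; rewrite tape_cells_cons /=.
have -> : (Posz (size l).+1 - 1 = Posz (size l))%R by lia.
by rewrite eqxx.
Qed.

Definition represents (c : config sim) (s : Q * stacks) : Prop :=
  [/\ c_state c = Some (s.1, false),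
      forall j, c_head c j = Posz (size (s.2 (stack_of j)))
    & forall j p, c_tape c j p = tape_cells (s.2 (stack_of j)) p].

Lemma represents_step c s : represents c s ->
  represents (tm_step (tm_step c)) (sm_step s).
Proof.
case: s => q stk [/= sc hdE tpE]; rewrite /sm_step /=.
case hq: (halt q).
  have e : tm_step c = c by rewrite /tm_step sc /= hq.
  by rewrite !e.
have := @tm_stepE _ sim c; rewrite sc /= hq => /(_ isT).
move: (tm_step c) => c1 [s1 h1 t1].
(* If the popped stack is empty, its head goes to cell -1 and reads a blank there; the second
   machine step moves it back. *)
have {}h1 j : c_head c1 j = (if stack_of j == psel q then Posz (size (stk (stack_of j))) - 1
                             else Posz (size (stk (stack_of j))))%R.
  by rewrite h1 hdE ffunE; case: ifP => _; rewrite /= ?inordK //; lia.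
have {}t1 j p : c_tape c1 j p = tape_cells (stk (stack_of j)) p.
  by rewrite t1 ffunE -tpE; case: eqP => [->|].
have := @tm_stepE _ sim c1; rewrite s1 /= => /(_ isT).
have -> : reads c1 (tape_of (psel q)) = ohead (stk (psel q)).
  by rewrite ffunE t1 h1 tape_ofK eqxx tape_cells_top.
move: (tm_step c1) => c2; set n := nxt _ _ => -[s2 h2 t2]; split=> //= [j|j p].
  rewrite h2 h1 !ffunE; case: (stack_of j =P psel q) => [->|_].
    by case: (stk (psel q)) => [|g l] /=; rewrite ?inordK //; lia.
  by case: (n.2 _) => [g|] /=; rewrite ?inordK //; lia.
rewrite t2 t1 h1 !ffunE; case: (stack_of j =P psel q) => [->|dj].
  case: (stk (psel q)) => [|g l] /=; first by case: ifP => _; case: p => [[|m]|m].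
  rewrite tape_cells_cons.
  have -> : (Posz (size l).+1 - 1 = Posz (size l))%R by lia.
  by case: eqP => // ->; rewrite tape_cells_out.
case: (n.2 _) => [g|]; first by rewrite tape_cells_cons.
by rewrite t1 h1 (negbTE (introN eqP dj)); case: eqP => // ->.
Qed.

Lemma scan_input w k : k <= size w -> exists c,
  [/\ run sim k w = c, c_state c = None,
     forall j, c_head c j = Posz (if j == ord0 then k else 0)
   & forall j p, c_tape c j p = c_tape (init_config sim w) j p].
Proof.
elim: k => [_|k IHk lt_k]; first by eexists; split=> // j; rewrite /= if_same.
have [c [e sc hc tc]] := IHk (ltnW lt_k).
have := @tm_stepE _ sim c; rewrite sc => /(_ isT).
have := onthTE w k; rewrite lt_k; case ek: (onth w k) => [a|] // _.
have er : reads c ord0 = Some (inp a) by rewrite ffunE tc hc eqxx /= ek.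
rewrite /= er /= => -[s1 h1 t1].
exists (tm_step c); split=> //; first by rewrite -e.
  by move=> j; rewrite h1 hc ffunE; case: ifP => _; rewrite ?inordK //=; lia.
by move=> j p; rewrite t1 ffunE tc; case: eqP => [->|].
Qed.

Lemma represents_init w : represents (run sim (size w).+1 w) (sm_init w).
Proof.
have [c [e sc hc tc]] := scan_input (leqnn (size w)).
rewrite -[run _ _ _]/(tm_step (run sim (size w) w)) e.
have := @tm_stepE _ sim c; rewrite sc => /(_ isT).
have er : reads c ord0 = None by rewrite ffunE tc hc eqxx /= onth_default.
rewrite /= er /= => -[s1 h1 t1]; split=> // [j|j p].
  rewrite h1 hc ffunE inordK // -[ord0]/(tape_of None) eq_tape_of.
  by case: (stack_of j) => [i|] /=; rewrite ?size_rev ?size_map; lia.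
have {}t1 : c_tape (tm_step c) j p = c_tape c j p by rewrite t1 ffunE; case: eqP => [->|].
rewrite {}t1 tc /= -[ord0]/(tape_of None) eq_tape_of.
case: (stack_of j) => [i|] /=; first by case: p => [[|m]|m].
by case: p => // m; rewrite /= revK onth_map; case: (onth w m).
Qed.

Lemma represents_run w n : represents (run sim ((size w).+1 + n.*2) w) (sm_run n w).
Proof.
elim: n => [|n IHn]; first by rewrite addn0; exact: represents_init.
by rewrite doubleS !addnS; exact: represents_step.
Qed.

Lemma sim_decides (L : seq Sigma -> Prop) (T : nat -> nat) :
  (forall w, exists n, [/\ n <= T (size w), halt (sm_run n w).1
                         & acc (sm_run n w).1 <-> L w]) ->
  forall w, exists n, [/\ n <= (size w).+1 + (T (size w)).*2,
    tm_halt sim (c_state (run sim n w)) & tm_acc sim (c_state (run sim n w)) <-> L w].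
Proof.
move=> dec w; have [n [le_n hn an]] := dec w.
have [sn _ _] := represents_run w n.
by exists ((size w).+1 + n.*2); rewrite sn leq_add2l leq_double.
Qed.

End StackMachine.

(** * The level-by-level search *)

Section ProgramState.
Variables (X : finType) (C K : nat).

(* [Qhalve b h fl] halves the unary counter [sH b] into [sH (~~ b)], with [h] a
   pending mark and [fl] set once a mark was output. In [Qlev c dir f e], [f y] is
   the image of [y] under the letters of the current word read so far, and [e y]
   tells whether a nontrivial letter of its section at [y] was output. [c] counts
   levels between two ticks of the clock, and [dir] gives the directions of its digits. *)
Inductive pstate :=
| Qstart | Qread | Qacc | Qrej
| Qhalve (b h fl : bool)
| Qlev (c : 'I_C.+1) (dir : {ffun 'I_K.+1 -> bool}) (f : {ffun X -> X}) (e : {ffun X -> bool})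
| Qcopy (c : 'I_C.+1) (dir : {ffun 'I_K.+1 -> bool}) (i : 'I_#|X|.+1)
| Qtick (dir : {ffun 'I_K.+1 -> bool}) (j : 'I_K.+1).

Definition pstate_code : Type :=
  (bool * bool + bool * bool * bool
   + 'I_C.+1 * {ffun 'I_K.+1 -> bool} * {ffun X -> X} * {ffun X -> bool}
   + 'I_C.+1 * {ffun 'I_K.+1 -> bool} * 'I_#|X|.+1
   + {ffun 'I_K.+1 -> bool} * 'I_K.+1)%type.

Definition pstate_enc (q : pstate) : pstate_code :=
  match q with
  | Qstart => inl (inl (inl (inl (false, false))))
  | Qread => inl (inl (inl (inl (false, true))))
  | Qacc => inl (inl (inl (inl (true, false))))
  | Qrej => inl (inl (inl (inl (true, true))))
  | Qhalve b h fl => inl (inl (inl (inr (b, h, fl))))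
  | Qlev c dir f e => inl (inl (inr (c, dir, f, e)))
  | Qcopy c dir i => inl (inr (c, dir, i))
  | Qtick dir j => inr (dir, j)
  end.

Definition pstate_dec (u : pstate_code) : pstate :=
  match u with
  | inl (inl (inl (inl (false, false)))) => Qstart
  | inl (inl (inl (inl (false, true)))) => Qread
  | inl (inl (inl (inl (true, false)))) => Qacc
  | inl (inl (inl (inl (true, true)))) => Qrej
  | inl (inl (inl (inr (b, h, fl)))) => Qhalve b h fl
  | inl (inl (inr (c, dir, f, e))) => Qlev c dir f e
  | inl (inr (c, dir, i)) => Qcopy c dir i
  | inr (dir, j) => Qtick dir j
  end.

Lemma pstate_encK : cancel pstate_enc pstate_dec.
Proof. by case. Qed.

HB.instance Definition _ := Countable.copy pstate (can_type pstate_encK).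
HB.instance Definition _ : isFinite pstate := CanIsFinite pstate_encK.

End ProgramState.

Arguments Qstart {X C K}. Arguments Qread {X C K}. Arguments Qacc {X C K}. Arguments Qrej {X C K}.
Arguments Qhalve {X C K}. Arguments Qlev {X C K}. Arguments Qcopy {X C K}.
Arguments Qtick {X C K}.

Section Program.
Variables (X S : finType) (t : S -> X -> S) (o : S -> X -> X) (nt : S -> bool).
Variables (x0 : X) (C K : nat).

Let G := option S.
Let I := (option X + bool + 'I_K.+1 * bool)%type.

Definition sA : option I := Some (inl (inl None)).
Definition sB (x : X) : option I := Some (inl (inl (Some x))).
Definition sH (b : bool) : option I := Some (inl (inr b)).
Definition sCk (j : 'I_K.+1) (b : bool) : option I := Some (inr (j, b)).

(** The type [T] is arbitrary, to serve both for the contents of the stacks and for the symbols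
    pushed on them. *)
Definition pack T (i : T) (a : T) (b : X -> T) (h : bool -> T) (ck : 'I_K.+1 -> bool -> T)
    (s : option I) : T :=
  match s with
  | None => i
  | Some (inl (inl None)) => a
  | Some (inl (inl (Some x))) => b x
  | Some (inl (inr c)) => h c
  | Some (inr (j, c)) => ck j c
  end.

Notation none1 := (fun=> None).
Notation none2 := (fun _ _ => None).

Let f0 : {ffun X -> X} := [ffun x => x].
Let e0 : {ffun X -> bool} := [ffun => false].
Let dir0 : {ffun 'I_K.+1 -> bool} := [ffun => false].

Definition lev_state (c : 'I_C.+1) dir : pstate X C K := Qlev c dir f0 e0.
Definition after_level (c : 'I_C.+1) dir : pstate X C K :=
  if c == ord_max then Qtick dir ord0 else lev_state (inord c.+1) dir.

(** Every step pops a stack. [Qstart] pops [sH true], which is still empty, so that the input stays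
    intact while the first separator is pushed on [sA]. *)
Definition prog_sel (q : pstate X C K) : option I :=
  match q with
  | Qstart => sH true
  | Qread | Qacc | Qrej => None
  | Qhalve b _ _ => sH b
  | Qlev _ _ _ _ => sA
  | Qcopy _ _ i => sB (nth x0 (enum X) i)
  | Qtick dir j => sCk j (dir j)
  end.

(** Reading copies the input to [sA] and its length in unary to [sH false]; halving then sets the
    clock digits. Each level distributes the sections of the words on [sA] to the stacks [sB y] and
    copies them back to [sA]. *)
Definition prog_nxt (q : pstate X C K) (g : option G) : pstate X C K * (option I -> option G) :=
  match q with
  | Qstart => (Qread, pack None (Some None) none1 none1 none2)
  | Qread =>
    if g is Some g' then
      (Qread, pack None (Some g') none1 (fun b => if b then None else Some None) none2)
    else (Qhalve false false false, none1)
  | Qacc => (Qacc, none1)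
  | Qrej => (Qrej, none1)
  | Qhalve b h fl =>
    if g is Some _ then
      if h then (Qhalve b false true, pack None None none1 (fun=> Some None) none2)
      else (Qhalve b true fl, none1)
    else (if fl then Qhalve (~~ b) false false else lev_state ord0 dir0,
          pack None None none1 none1 (fun _ b => if b then None else Some None))
  | Qlev c dir f e =>
    match g with
    | Some (Some s) =>
      (Qlev c dir [ffun y => o s (f y)] [ffun y => e y || nt (t s (f y))],
       pack None None (fun y => if nt (t s (f y)) then Some (Some (t s (f y))) else None)
            none1 none2)
    | Some None =>
      if [forall y, f y == y] then
        (lev_state c dir, pack None None (fun y => if e y then Some None else None) none1 none2)
      else (Qrej, none1)
    | None => (Qcopy c dir ord0, none1)
    end
  | Qcopy c dir i =>
    if g is Some g' then (Qcopy c dir i, pack None (Some g') none1 none1 none2)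
    else (if i.+1 == #|X| then after_level c dir else Qcopy c dir (inord i.+1), none1)
  | Qtick dir j =>
    if g is Some g' then
      (lev_state ord0 dir, pack None None none1 none1
         (fun j' b => if j' == j then Some g' else None))
    else (if j == ord_max then Qacc
          else Qtick [ffun j' => if j' == j then ~~ dir j else dir j'] (inord j.+1), none1)
  end.

Definition prog_halt (q : pstate X C K) := match q with Qacc | Qrej => true | _ => false end.
Definition prog_acc (q : pstate X C K) := if q is Qacc then true else false.

Let step := sm_step prog_halt prog_sel prog_nxt.

Let push (g : option G) (l : seq G) := if g is Some g' then g' :: l else l.

Lemma stepE q stk : ~~ prog_halt q ->
  step (q, stk) =
  let r := prog_nxt q (ohead (stk (prog_sel q))) in
  (r.1, fun i => if i == prog_sel q then behead (stk i) else push (r.2 i) (stk i)).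
Proof. by rewrite /step /sm_step /= => /negbTE->. Qed.

Ltac unfold_stacks :=
  apply: functional_extensionality => -[[[[y|]|c']|[j' c']]|] //=.

Lemma steps_read l a b n h ck :
  iter (size l).+1 step (Qread, pack l a b (fun c => if c then h else nseq n None) ck) =
  (Qhalve false false false,
   pack [::] (rev l ++ a) b (fun c => if c then h else nseq (size l + n) None) ck).
Proof.
elim: l a n => [|g l IHl] a n.
  by rewrite /= stepE //=; congr pair; unfold_stacks.
have e1 : step (Qread, pack (g :: l) a b (fun c => if c then h else nseq n None) ck) =
  (Qread, pack l (g :: a) b (fun c => if c then h else nseq n.+1 None) ck).
  by rewrite stepE //; congr pair; unfold_stacks; case: ifP.
by rewrite iterSr e1 IHl rev_cons cat_rcons addnS.
Qed.

Lemma step_start i b ck :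
  step (Qstart, pack i [::] b (fun=> [::]) ck) = (Qread, pack i [:: None] b (fun=> [::]) ck).
Proof. by rewrite stepE //; congr pair; unfold_stacks; case: ifP. Qed.

Definition halves (b : bool) (n m : nat) : bool -> seq G :=
  fun c => if c == b then nseq n None else nseq m None.

Definition clocks (m : nat) : 'I_K.+1 -> bool -> seq G :=
  fun _ c => if c then [::] else nseq m None.

Lemma steps_halve b (h fl : bool) n m i a bb ck :
  iter n step (Qhalve b h fl, pack i a bb (halves b n m) ck) =
  (Qhalve b (odd (n + h)) (fl || (0 < (n + h)./2)),
   pack i a bb (halves b 0 (m + (n + h)./2)) ck).
Proof.
elim: n m h fl => [|n IHn] m h fl; first by case: h; rewrite /= addn0 orbF.
have e1 : step (Qhalve b h fl, pack i a bb (halves b n.+1 m) ck) =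
    (Qhalve b (~~ h) (fl || h), pack i a bb (halves b n (m + h)) ck).
  rewrite stepE //= /halves eqxx /=.
  by case: h; rewrite ?orbT ?orbF /=; congr pair; unfold_stacks; rewrite /halves;
    case: eqP => [[->]|dc]; rewrite ?eqxx ?addn1 ?addn0 //=; case: eqP => // e; case: dc; rewrite e.
rewrite iterSr e1 IHn; case: h {e1} => /=; congr (Qhalve _ _ _, pack _ _ _ _ _).
all: rewrite ?addn0 ?addn1 /= ?negbK ?orbT ?orbF //.
by congr (halves _ _ _); lia.
Qed.

(** Each round halves the counter and leaves one mark per clock digit; the lengths of the rounds
    decrease geometrically, so the total is linear. *)
Lemma steps_log b n m i a bb : exists2 T, T <= 3 * n + 1 &
  iter T step (Qhalve b false false, pack i a bb (halves b n 0) (clocks m)) =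
  (lev_state ord0 dir0, pack i a bb (fun=> [::]) (clocks (m + (trunc_log 2 n).+1))).
Proof.
elim/ltn_ind: n b m => n IHn b m.
have e1 : iter n.+1 step (Qhalve b false false, pack i a bb (halves b n 0) (clocks m)) =
    (if 0 < n./2 then Qhalve (~~ b) false false else lev_state ord0 dir0,
     pack i a bb (halves (~~ b) n./2 0) (clocks m.+1)).
  rewrite iterS steps_halve addn0 /= stepE //= /halves eqxx /=.
  congr pair; unfold_stacks; last by case: c'.
  by rewrite /halves; case: b c' => [] [].
case: (posnP n./2) e1 => [n0|n0] e1.
  exists n.+1; first by lia.
  rewrite e1 n0; congr (_, pack _ _ _ _ _).
    by apply: functional_extensionality => c; rewrite /halves if_same.
  have -> : trunc_log 2 n = 0 by case: n n0 {IHn e1} => [|[|n]].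
  by rewrite addn1.
have n1 : 1 < n by case: n n0 {IHn e1} => [|[|n]].
have [|T leT eT] := IHn n./2 _ (~~ b) m.+1; first by lia.
exists (T + n.+1); first by lia.
rewrite iterD e1 eT (trunc_log2S n1); congr (_, pack _ _ _ _ (clocks _)); lia.
Qed.

(** Deleting trivial letters keeps the action and lets [growth] control the length. *)
Definition clean_sec (u : seq S) (x : X) : seq S := [seq s <- section_word t o u x | nt s].

(* A stack holds a list of words, each followed by the separator [None]. *)
Definition enc (us : seq (seq S)) : seq G := flatten [seq rcons (map Some u) None | u <- us].

Definition triv_letter (u : seq S) : bool := [forall y, olet o u y == y].

(** Empty words are dropped: they act trivially, and their separators would multiply from level to
    level. *)
Definition next_words (us : seq (seq S)) (y : X) : seq (seq S) :=
  [seq c <- [seq clean_sec u y | u <- us] | c != [::]].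

(** Pushing reverses each section; copying back to [sA] restores its order. *)
Lemma steps_word c dir f e u rest i b h ck :
  let r := iter (size u).+1 step
             (Qlev c dir f e, pack i (map Some u ++ None :: rest) b h ck) in
  if [forall y, olet o u (f y) == y] then
    r = (lev_state c dir, pack i rest (fun y =>
      (if e y || (clean_sec u (f y) != [::]) then [:: None] else [::])
      ++ rev (map Some (clean_sec u (f y))) ++ b y) h ck)
  else r.1 = Qrej.
Proof.
elim: u f e b => [|s u IHu] f e b; cbv zeta.
  rewrite /= stepE //=; case: ifP => hf; rewrite /= in hf; rewrite hf //=.
  by congr pair; unfold_stacks; rewrite orbF; case: (e _).
have e1 : step (Qlev c dir f e, pack i (map Some (s :: u) ++ None :: rest) b h ck) =
    (Qlev c dir [ffun y => o s (f y)] [ffun y => e y || nt (t s (f y))],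
     pack i (map Some u ++ None :: rest)
       (fun y => (if nt (t s (f y)) then [:: Some (t s (f y))] else [::]) ++ b y) h ck).
  by rewrite stepE //=; congr pair; unfold_stacks; case: (nt _).
have := IHu [ffun y => o s (f y)] [ffun y => e y || nt (t s (f y))]
  (fun y => (if nt (t s (f y)) then [:: Some (t s (f y))] else [::]) ++ b y).
cbv zeta; rewrite [size (s :: u)]/= [iter _.+2 _ _]iterSr e1.
rewrite (_ : [forall y, olet o u ([ffun y => o s (f y)] y) == y]
           = [forall y, olet o (s :: u) (f y) == y]); last first.
  by apply: eq_forallb => y; rewrite ffunE.
case: ifP => // _ ->; congr (_, pack _ _ _ _ _).
apply: functional_extensionality => y; rewrite !ffunE /clean_sec /=.
case: (nt _); rewrite ?orbT ?orbF // /= rev_cons cat_rcons; exact: erefl.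
Qed.

Lemma iter_rej n q : q.1 = Qrej -> (iter n step q).1 = Qrej.
Proof. by elim: n => // n IHn /IHn h; rewrite iterS [step _]/sm_step h. Qed.

Lemma size_enc us : size (enc us) = \sum_(u <- us) (size u).+1.
Proof.
elim: us => [|u us IHus]; first by rewrite big_nil.
by rewrite big_cons /enc /= size_cat size_rcons size_map IHus.
Qed.

Lemma enc_cons u us : enc (u :: us) = map Some u ++ None :: enc us.
Proof. by rewrite /enc /= cat_rcons. Qed.

Lemma enc_cat us vs : enc (us ++ vs) = enc us ++ enc vs.
Proof. by rewrite /enc map_cat flatten_cat. Qed.

Lemma steps_words c dir us i b h ck :
  let r := iter (size (enc us)) step (lev_state c dir, pack i (enc us) b h ck) in
  if all triv_letter us then
    r = (lev_state c dir, pack i [::] (fun y => rev (enc (next_words us y)) ++ b y) h ck)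
  else r.1 = Qrej.
Proof.
elim: us b => [|u us IHus] b //; cbv zeta.
have := steps_word c dir f0 e0 u (enc us) i b h ck; cbv zeta.
rewrite enc_cons size_cat size_map [size (_ :: _)]/= -addSnnS addnC iterD.
rewrite (_ : [forall y, olet o u (f0 y) == y] = triv_letter u); last first.
  by apply: eq_forallb => y; rewrite ffunE.
rewrite [all _ _]/=; case: (triv_letter u) => [->|hr]; last exact: iter_rej.
set b1 := (X in pack _ _ X); have := IHus b1; cbv zeta.
rewrite [true && _]/=; case: ifP => // _ ->; congr (_, pack _ _ _ _ _).
apply: functional_extensionality => y; rewrite /b1 !ffunE /next_words /=.
case: eqP => [->|/eqP nz] //=; rewrite enc_cons rev_cat rev_cons cat_rcons.
by rewrite -catA.
Qed.

Definition next_level (us : seq (seq S)) : seq (seq S) :=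
  foldl (fun vs y => next_words us y ++ vs) [::] (enum X).

Lemma steps_copy_one c dir (i : 'I_#|X|.+1) inp a b l h ck :
  iter (size l) step (Qcopy c dir i,
    pack inp a (fun y => if y == nth x0 (enum X) i then l else b y) h ck) =
  (Qcopy c dir i, pack inp (rev l ++ a)
    (fun y => if y == nth x0 (enum X) i then [::] else b y) h ck).
Proof.
elim: l a => [|g l IHl] a //.
rewrite [size _]/= iterSr rev_cons cat_rcons -IHl; congr (iter _ _ _).
rewrite stepE //= eqxx /=; congr pair; unfold_stacks.
have -> : (Some (inl (inl (Some y))) == sB (nth x0 (enum X) i)) = (y == nth x0 (enum X) i).
  by [].
by case: eqP.
Qed.

Lemma step_copy_end c dir (i : 'I_#|X|.+1) inp a b h ck : b (nth x0 (enum X) i) = [::] ->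
  step (Qcopy c dir i, pack inp a b h ck) =
  (if i.+1 == #|X| then after_level c dir else Qcopy c dir (inord i.+1), pack inp a b h ck).
Proof.
move=> b0; rewrite stepE //= b0 /=; congr pair; unfold_stacks.
have -> : (Some (inl (inl (Some y))) == sB (nth x0 (enum X) i)) = (y == nth x0 (enum X) i).
  by [].
by case: eqP => // ->; rewrite b0.
Qed.

Lemma steps_copy c dir m inp a (v : X -> seq G) h ck (i : 'I_#|X|.+1) :
  m + i = #|X| -> 0 < m ->
  iter (\sum_(y <- drop i (enum X)) (size (v y)).+1) step
    (Qcopy c dir i, pack inp a (fun y => if index y (enum X) < i then [::] else v y) h ck) =
  (after_level c dir,
   pack inp (foldl (fun a y => rev (v y) ++ a) a (drop i (enum X))) (fun=> [::]) h ck).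
Proof.
elim: m a i => // m IHm a i eqm _.
have szX : m.+1 + i = size (enum X) by rewrite eqm cardE.
have lti : i < size (enum X) by rewrite -szX addSn ltnS leq_addl.
rewrite (drop_nth x0 lti) big_cons [foldl _ _ _]/= addnC iterD.
set y0 := nth x0 (enum X) i.
have ey0 : index y0 (enum X) = i by rewrite index_uniq // enum_uniq.
have -> : (fun y => if index y (enum X) < i then [::] else v y) =
    (fun y => if y == y0 then v y0 else if index y (enum X) < i then [::] else v y).
  by apply: functional_extensionality => y; case: eqP => // ->; rewrite ey0 ltnn.
rewrite iterS steps_copy_one step_copy_end ?eqxx //.
have -> : (fun y => if y == y0 then [::] else if index y (enum X) < i then [::] else v y) =
    (fun y => if index y (enum X) < i.+1 then [::] else v y).
  apply: functional_extensionality => y; rewrite ltnS [in RHS]leq_eqVlt -ey0.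
  have -> : (index y (enum X) == index y0 (enum X)) = (y == y0).
    apply/eqP/eqP => [e|-> //].
    by rewrite -(nth_index x0 (mem_enum X y)) e nth_index // mem_enum.
  by case: eqP.
case: eqP => [ei|ni].
  rewrite drop_oversize -?cardE ?ei // big_nil /=; congr (_, pack _ _ _ _ _).
  by apply: functional_extensionality => y; rewrite cardE index_mem mem_enum.
have ei : (inord i.+1 : 'I_#|X|.+1) = i.+1 :> nat by rewrite inordK //; lia.
by have := IHm (rev (v y0) ++ a) (inord i.+1); rewrite ei; apply; lia.
Qed.

Lemma size_foldl_cat T (g : X -> seq T) a l :
  size (foldl (fun a y => g y ++ a) a l) = \sum_(y <- l) size (g y) + size a.
Proof.
elim: l a => [|y l IHl] a; first by rewrite big_nil.
by rewrite big_cons /= IHl size_cat; lia.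
Qed.

Lemma enc_next_level us :
  enc (next_level us) = foldl (fun a y => enc (next_words us y) ++ a) [::] (enum X).
Proof.
rewrite /next_level -[[::] in RHS]/(enc [::]).
elim: (enum X) (Nil (seq S)) => //= y l IHl a; by rewrite IHl enc_cat.
Qed.

(** One step per symbol read or copied, and one for finding [sA] and each [sB y] empty. *)
Definition level_cost us := size (enc us) + size (enc (next_level us)) + #|X|.+1.

Lemma steps_level c dir us i h ck :
  let r := iter (level_cost us) step (lev_state c dir, pack i (enc us) (fun=> [::]) h ck) in
  if all triv_letter us then
    r = (after_level c dir, pack i (enc (next_level us)) (fun=> [::]) h ck)
  else r.1 = Qrej.
Proof.
have X0 : 0 < #|X| by apply/card_gt0P; exists x0.
have := steps_words c dir us i (fun=> [::]) h ck; cbv zeta.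
rewrite /level_cost -addnA addnC iterD; case: ifP => [_ ->|_ hr]; last exact: iter_rej.
pose v y := rev (enc (next_words us y)) ++ [::].
have e1 : step (lev_state c dir, pack i [::] v h ck) = (Qcopy c dir ord0, pack i [::] v h ck).
  by rewrite stepE //=; congr pair; unfold_stacks.
rewrite addnS iterSr e1.
have e2 : size (enc (next_level us)) + #|X| =
    \sum_(y <- drop (ord0 : 'I_#|X|.+1) (enum X)) (size (v y)).+1.
  rewrite drop0 enc_next_level size_foldl_cat addn0 cardE.
  rewrite -[size (enum X)](sum1_size) -big_split; apply: eq_bigr => y _.
  by rewrite /= /v cats0 size_rev addn1.
rewrite e2; have := @steps_copy c dir #|X| i [::] v h ck ord0 (addn0 _) X0.
rewrite drop0 => ->; congr (_, pack _ _ _ _ _); rewrite enc_next_level.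
have -> // : (fun a y => rev (v y) ++ a) = (fun a y => enc (next_words us y) ++ a).
apply: functional_extensionality => l; apply: functional_extensionality => y.
by rewrite /v cats0 revK.
Qed.

(** * An odometer that counts the levels *)

Section Clock.
Variable m : nat.

(* Digit [j] of the odometer is the number of marks still to be moved from
   [sCk j (dir j)] to [sCk j (~~ dir j)]; when it is exhausted, flipping [dir j]
   resets it to [m]. *)
Definition clock_state (dir : {ffun 'I_K.+1 -> bool}) (v : 'I_K.+1 -> nat) :
  'I_K.+1 -> bool -> seq G :=
  fun j b => if b == dir j then nseq (v j) None else nseq (m - v j) None.

Definition clock_val (v : 'I_K.+1 -> nat) := \sum_(j < K.+1) v j * m.+1 ^ j.

Lemma clock_val_upd v j x : clock_val (fun j' => if j' == j then x else v j') + v j * m.+1 ^ j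
  = clock_val v + x * m.+1 ^ j.
Proof.
rewrite /clock_val (bigD1 j) //= eqxx [in RHS](bigD1 j) //=.
rewrite (eq_bigr (fun i : 'I_K.+1 => v i * m.+1 ^ i)) => [|i /negbTE-> //]; lia.
Qed.

Lemma clock_val_lt v : (forall j, v j <= m) -> v ord_max = 0 -> clock_val v < m.+1 ^ K.
Proof.
move=> le_v v0; rewrite /clock_val big_ord_recr /= v0 mul0n addn0.
have : forall n (u : 'I_n -> nat), (forall j, u j <= m) -> \sum_(j < n) u j * m.+1 ^ j < m.+1 ^ n.
  elim=> [|n IHn] u le_u; first by rewrite big_ord0.
  rewrite big_ord_recr /= expnS mulSn.
  have /= := IHn (fun j => u (widen_ord (leqnSn n) j)) (fun j => le_u _).
  have : u ord_max * m.+1 ^ n <= m * m.+1 ^ n by rewrite leq_mul2r le_u orbT.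
  lia.
by move=> h; apply: (h K (fun j => v (widen_ord (leqnSn K) j))).
Qed.

(** When the borrow reaches digit [j], the lower digits have been reset from 0 to [m], which has
    added [(m + 1) ^ j - 1] to the value [V] before the tick. *)
Lemma steps_tick n dir v (j : 'I_K.+1) V i a b h : n + j = K.+1 -> (forall j', v j' <= m) ->
  clock_val v + 1 = V + m.+1 ^ j -> exists2 T, T <= n &
  exists dir' v' q, iter T step (Qtick dir j, pack i a b h (clock_state dir v)) =
      (q, pack i a b h (clock_state dir' v')) /\
    ((V = 0 /\ q = Qacc) \/
     [/\ q = lev_state ord0 dir', forall j', v' j' <= m & clock_val v' + 1 = V]).
Proof.
elim: n j dir v => [|n IHn] j dir v eqn le_v eqV; first by have := ltn_ord j; lia.
case vj: (v j) => [|x].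
  set dir' := [ffun j' => if j' == j then ~~ dir j else dir j'].
  pose v' j' := if j' == j then m else v j'.
  have e1 : step (Qtick dir j, pack i a b h (clock_state dir v)) =
      (if j == ord_max then Qacc else Qtick dir' (inord j.+1),
       pack i a b h (clock_state dir' v')).
    rewrite stepE //= /clock_state eqxx vj /=; congr pair; unfold_stacks.
    rewrite ffunE /v' /sCk -[Some _ == _]/((j' == j) && (c' == dir j)).
    case: eqP => [->|_] //=; rewrite vj subn0 subnn.
    by case: c' (dir j) => [] [].
  have le_v' j' : v' j' <= m by rewrite /v'; case: eqP.
  have val' : clock_val v' + 1 = V + m.+1 ^ j.+1.
    have := clock_val_upd v j m; rewrite -/v' vj expnS; lia.
  case: (j =P ord_max) e1 => [ej|nj] e1.
    (* The top digit is exhausted, and [clock_val_lt] forces [V = 0]. *)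
    exists 1 => //; exists dir', v', Qacc; split=> //; left; split=> //.
    by have := clock_val_lt le_v; rewrite -ej vj => /(_ erefl); rewrite ej /= in eqV *; lia.
  have ltj : j < K.
    have := ltn_ord j; rewrite ltnS leq_eqVlt => /orP[/eqP e|//].
    by case: nj; apply: val_inj.
  have ej : (inord j.+1 : 'I_K.+1) = j.+1 :> nat by rewrite inordK.
  have [||T leT [d2 [v2 [q [eT h2]]]]] := IHn (inord j.+1) dir' v' _ le_v'.
  - by rewrite ej; lia.
  - by rewrite ej.
  exists T.+1 => //; exists d2, v2, q; split=> //.
  by rewrite iterSr e1.
pose v' j' := if j' == j then x else v j'.
exists 1 => //; exists dir, v', (lev_state ord0 dir); split.
  rewrite /= stepE //= /clock_state eqxx vj /=; congr pair; unfold_stacks.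
  rewrite /v' /sCk -[Some _ == _]/((j' == j) && (c' == dir j)).
  case: eqP => [->|_] //=; rewrite vj; have := le_v j; rewrite vj => le_x.
  case: eqP => // _; have -> : m - x = (m - x.+1).+1 by lia.
  by [].
right; split=> //.
  by move=> j'; rewrite /v'; case: eqP => // _; have := le_v j; lia.
have := clock_val_upd v j x; rewrite -/v' vj; lia.
Qed.

(** [R] counts the levels left: [C.+1] per unit of the clock, and those up to the next tick. A level
    costs at most [2 * M + #|X|.+1] steps, a tick at most [K.+1]. *)
Lemma steps_main M R (c : 'I_C.+1) dir v us i h :
  R = clock_val v * C.+1 + (C.+1 - c) -> (forall j, v j <= m) ->
  (forall l, l <= R -> size (enc (iter l next_level us)) <= M) ->
  exists2 T, T <= R * (2 * M + (#|X| + K.+2)) &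
  let r := iter T step (lev_state c dir, pack i (enc us) (fun=> [::]) h (clock_state dir v)) in
  r.1 = Qacc /\ (forall l, l < R -> all triv_letter (iter l next_level us)) \/
  r.1 = Qrej /\ ~ (forall l, l < R -> all triv_letter (iter l next_level us)).
Proof.
elim: R c dir v us => [|R IHR] c dir v us eqR le_v bnd; first by have := ltn_ord c; lia.
have cost : level_cost us <= 2 * M + #|X|.+1.
  by have := bnd 0 isT; have := bnd 1 isT; rewrite /level_cost /=; lia.
have := steps_level c dir us i h (clock_state dir v); cbv zeta.
case: ifP => [ok_us elev|nok hr]; last first.
  exists (level_cost us); first by rewrite mulSn; apply: leq_trans cost _; lia.
  by right; split=> // /(_ 0 isT) /=; rewrite nok.
have okS : (forall l, l < R.+1 -> all triv_letter (iter l next_level us)) <->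
    (forall l, l < R -> all triv_letter (iter l next_level (next_level us))).
  split=> [h1 l ltl|h1 [|l] ltl] //; first by have := h1 l.+1 ltl; rewrite iterSr.
  by rewrite iterSr; exact: h1.
have bnd' l : l <= R -> size (enc (iter l next_level (next_level us))) <= M.
  by move=> le_l; have := bnd l.+1 le_l; rewrite iterSr.
have finish (c' : 'I_C.+1) dir' v' T1 : R = clock_val v' * C.+1 + (C.+1 - c') -> (forall j, v' j <= m) ->
    T1 <= K.+1 ->
    iter (T1 + level_cost us) step
      (lev_state c dir, pack i (enc us) (fun=> [::]) h (clock_state dir v)) =
    (lev_state c' dir',
     pack i (enc (next_level us)) (fun=> [::]) h (clock_state dir' v')) ->
    exists2 T, T <= R.+1 * (2 * M + (#|X| + K.+2)) &
    let r := iter T step (lev_state c dir, pack i (enc us) (fun=> [::]) h (clock_state dir v)) in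
    r.1 = Qacc /\ (forall l, l < R.+1 -> all triv_letter (iter l next_level us)) \/
    r.1 = Qrej /\ ~ (forall l, l < R.+1 -> all triv_letter (iter l next_level us)).
  move=> eqR' le_v' leT1 e1.
  have [T leT hT] := IHR c' dir' v' (next_level us) eqR' le_v' bnd'.
  exists (T + (T1 + level_cost us)).
    by rewrite mulSn addnC; apply: leq_add => //; lia.
  by cbv zeta; rewrite iterD e1; case: hT => -[-> hT]; [left|right]; rewrite okS.
move: elev; rewrite /after_level; case: eqP => [ec|nc] elev; last first.
  have ltc : c < C.
    have := ltn_ord c; rewrite ltnS leq_eqVlt => /orP[/eqP e|//].
    by case: nc; apply: val_inj.
  apply: (finish (inord c.+1) dir v 0) => //.
  by rewrite inordK // ; move: eqR; lia.
have [||T leT [dir' [v' [q [eT [[V0 eq]|[eq le_v' eqV]]]]]]] :=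
    @steps_tick K.+1 dir v ord0 (clock_val v) i (enc (next_level us)) (fun=> [::]) h _ le_v.
- by rewrite addn0.
- by rewrite expn0.
- have R0 : R = 0 by move: eqR; rewrite V0 ec /=; lia.
  exists (T + level_cost us).
    by rewrite R0 mul1n addnC addnCA; lia.
  left; split; first by rewrite iterD elev eT eq.
  by rewrite R0 => -[].
apply: (finish ord0 dir' v' T) => //; last by rewrite iterD elev eT eq.
by move: eqR; rewrite ec -eqV /=; lia.
Qed.

End Clock.

(** * Total length and correctness of the levels *)

Hypotheses (o_inj : invertible o) (S_min : minimal t o).
Hypothesis ntP : forall s, nt s <-> nontrivial_state t o s.

Lemma growth_triv s n : ~~ nt s -> growth t nt s n = 0.
Proof.
elim: n s => [|n IHn] s ns /=; first by rewrite (negbTE ns).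
by apply: big1 => x _; apply: IHn; exact: (triv_t ntP).
Qed.

(** Since each [o s] is a permutation, the letter reaching a given position of [u] runs over the
    whole alphabet as [x] does. *)
Lemma sum_section (F : S -> nat) u :
  \sum_(x : X) \sum_(s <- section_word t o u x) F s = \sum_(s <- u) \sum_(x : X) F (t s x).
Proof.
elim: u => [|s u IHu] /=; first by rewrite !big_nil big1.
rewrite big_cons -IHu [X in _ + X](reindex_inj (@o_inj s)) -big_split /=.
by apply: eq_bigr => x _; rewrite big_cons.
Qed.

Lemma sum_foldl_cat T U (F : U -> nat) (g : T -> seq U) a l :
  \sum_(u <- foldl (fun a y => g y ++ a) a l) F u =
  \sum_(y <- l) \sum_(u <- g y) F u + \sum_(u <- a) F u.
Proof.
elim: l a => [|y l IHl] a /=; first by rewrite big_nil.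
by rewrite IHl big_cat big_cons /=; lia.
Qed.

Lemma sum_next_level (F : seq S -> nat) us : F [::] = 0 ->
  \sum_(u <- next_level us) F u = \sum_(u <- us) \sum_(y : X) F (clean_sec u y).
Proof.
move=> F0; rewrite /next_level sum_foldl_cat big_nil addn0 exchange_big /=.
rewrite big_enum /=; apply: eq_bigr => y _; rewrite big_filter big_map big_mkcond /=.
by apply: eq_bigr => u _; case: eqP => //= ->.
Qed.

Definition weight n us := \sum_(u <- us) \sum_(s <- u) growth t nt s n.

(** Depth is exchanged for growth without loss, because the deleted letters have growth 0. *)
Lemma weight_next n us : weight n (next_level us) = weight n.+1 us.
Proof.
rewrite /weight sum_next_level ?big_nil //; apply: eq_bigr => u _.
transitivity (\sum_(y : X) \sum_(s <- section_word t o u y) growth t nt s n).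
  apply: eq_bigr => y _; rewrite /clean_sec big_filter big_mkcond /=.
  by apply: eq_bigr => s _; case: (boolP (nt s)) => // /growth_triv->.
by rewrite sum_section.
Qed.

Lemma weight_iter n us : weight 0 (iter n next_level us) = weight n us.
Proof.
elim: n us => // n IHn us; by rewrite iterSr IHn weight_next.
Qed.

Lemma mem_next_level us c : reflect (exists u y, [/\ u \in us, c = clean_sec u y & c != [::]])
  (c \in next_level us).
Proof.
have -> : (c \in next_level us) = has (fun y => c \in next_words us y) (enum X).
  rewrite /next_level -[RHS]orbF -(in_nil c); elim: (enum X) [::] => //= y l IHl a.
  by rewrite IHl mem_cat; case: (c \in next_words us y); rewrite //= ?orbT.
apply: (iffP hasP) => [[y _]|[u [y [u_us -> nz]]]].
  by rewrite mem_filter => /andP[nz /mapP[u u_us e]]; exists u, y.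
by exists y; rewrite ?mem_enum // mem_filter nz; apply/mapP; exists u.
Qed.

(** As the words are nonempty, separators at most double the length. *)
Lemma size_enc_clean us : {in us, forall u, u != [::] /\ all nt u} ->
  size (enc us) <= 2 * weight 0 us.
Proof.
move=> cl; rewrite size_enc /weight big_distrr /= [X in X <= _]big_seq [X in _ <= X]big_seq.
apply: leq_sum => u /cl[nz nu].
have -> : \sum_(s <- u) nt s = size u.
  rewrite -sum1_size [LHS]big_seq [RHS]big_seq; apply: eq_bigr => s su.
  by rewrite (allP nu).
by case: u nz {nu} => //= s u _; lia.
Qed.

(** The input may be empty or contain trivial letters, so level 0 is counted apart by
    [(size w).+1]. *)
Lemma size_level w n :
  size (enc (iter n next_level [:: w])) <= 2 * \sum_(s <- w) growth t nt s n + (size w).+1.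
Proof.
case: n => [|n]; first by rewrite size_enc big_seq1 leq_addl.
apply: leq_trans (leq_addr _ _).
have -> : \sum_(s <- w) growth t nt s n.+1 = weight n.+1 [:: w] by rewrite /weight big_seq1.
rewrite -weight_iter; apply: size_enc_clean => c /=.
move=> /mem_next_level[u [y [_ -> nz]]]; split=> //; exact: filter_all.
Qed.

Lemma act_clean u v : act_word t o [seq s <- u | nt s] v = act_word t o u v.
Proof.
elim: u v => //= s u IHu v; case: (boolP (nt s)) => ns; rewrite [RHS]/act_word /=.
  exact: IHu.
by rewrite (triv_outs ntP).
Qed.

(** By [act_cons], the first letter is tested on the current level and the others through the
    cleaned section on the next; empty sections act trivially. *)
Lemma levels_triv R us : (forall l, l < R -> all triv_letter (iter l next_level us)) <->
  {in us, forall u v, size v <= R -> act_word t o u v = v}.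
Proof.
elim: R us => [|R IHR] us.
  split=> // _ u _ [|//] _; by apply: size0nil; rewrite size_act_word.
split=> [h u u_us v|h].
  have /allP/(_ u u_us)/forallP tu := h 0 isT.
  case: v => [_|y v szv]; first by apply: size0nil; rewrite size_act_word.
  rewrite act_cons (eqP (tu y)); congr (_ :: _); rewrite -act_clean.
  case: (clean_sec u y =P [::]) => [e|/eqP nz].
    by rewrite -/(clean_sec u y) e.
  apply: (proj1 (IHR (next_level us))) => //; last by apply/mem_next_level; exists u, y.
  by move=> l ltl; rewrite -iterSr; exact: h.
have /IHR hR : {in next_level us, forall u v, size v <= R -> act_word t o u v = v}.
  move=> c /mem_next_level[u [y [u_us -> _]]] v szv; rewrite act_clean.
  by have := h u u_us (y :: v) szv; rewrite act_cons => -[].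
case=> [_|l ltl]; last by rewrite iterSr; exact: hR.
apply/allP => u u_us; apply/forallP => y; apply/eqP.
by have := h u u_us [:: y] isT; rewrite act_cons => -[].
Qed.

Definition log_size (n : nat) := (trunc_log 2 n).+1.
(** The odometer has [K.+1] digits in base [log_size n + 1], and [C.+1] levels pass between
    ticks. *)
Definition level_count (n : nat) := C.+1 * (log_size n).+1 ^ K.+1.

Lemma program_decides C1 d w : (forall s n, growth t nt s n <= C1 * n.+1 ^ d) ->
  let n := size w in let R := level_count n in
  let M := 2 * (n * (C1 * R.+1 ^ d)) + n.+1 in
  let run k := sm_run (Q := pstate X C K) (G := G) Some Qstart prog_halt prog_sel prog_nxt k w in
  exists k, [/\ k <= 4 * n + 3 + R * (2 * M + (#|X| + K.+2)), prog_halt (run k).1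
    & prog_acc (run k).1 <-> (forall v, size v <= R -> act_word t o w v = v)].
Proof.
move=> bnd n R M; cbv zeta; set m := log_size n.
have bndM l : l <= R -> size (enc (iter l next_level [:: w])) <= M.
  move=> le_l; apply: leq_trans (size_level _ _) _; rewrite leq_add2r leq_mul2l /= /n.
  have bl s : growth t nt s l <= C1 * R.+1 ^ d.
    by apply: leq_trans (bnd s l) _; rewrite leq_mul2l leq_expn_r ?orbT.
  elim: (w) => [|s u IHu]; first by rewrite big_nil.
  by rewrite big_cons mulSn leq_add.
have val_m : clock_val m (fun=> m) = (m.+1 ^ K.+1).-1.
  rewrite /clock_val; elim: K.+1 => [|k IHk]; first by rewrite big_ord0.
  rewrite big_ord_recr /= IHk expnS; have : 0 < m.+1 ^ k by rewrite expn_gt0.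
  lia.
have eqR : R = clock_val m (fun=> m) * C.+1 + (C.+1 - (ord0 : 'I_C.+1)).
  rewrite val_m /R /level_count -/m; have : 0 < m.+1 ^ K.+1 by rewrite expn_gt0.
  move: (m.+1 ^ _) => a; rewrite /=; nia.
have [T0 leT0 eT0] := steps_log false n 0 [::] (enc [:: w]) (fun=> [::]).
have [T1 leT1 hT1] := @steps_main m M R ord0 dir0 (fun=> m) [:: w] [::] (fun=> [::]) eqR
  (fun=> leqnn m) bndM.
exists (T1 + (T0 + (n.+1 + 1))).
have le_T : T1 + (T0 + (n.+1 + 1)) <= 4 * n + 3 + R * (2 * M + (#|X| + K.+2)).
  by rewrite addnC; apply: leq_add => //; lia.
have run_init : sm_run (Q := pstate X C K) (G := G) Some Qstart prog_halt prog_sel prog_nxt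
    (T1 + (T0 + (n.+1 + 1))) w =
  iter T1 step (lev_state ord0 dir0,
    pack [::] (enc [:: w]) (fun=> [::]) (fun=> [::]) (clock_state m dir0 (fun=> m))).
  rewrite /sm_run -/step !iterD /=.
  have -> : sm_init (Q := pstate X C K) (G := G) _ Some Qstart w = (Qstart, pack (rev (map Some w)) [::] (fun=> [::]) (fun=> [::]) (clocks 0)).
    by congr pair; unfold_stacks; rewrite /clocks; case: c'.
  rewrite step_start.
  have -> : (fun=> [::]) = (fun c : bool => if c then [::] else nseq 0 None) :> (bool -> seq G).
    by apply: functional_extensionality => -[].
  rewrite -iterS; have -> : n.+1 = (size (rev (map (Some : S -> G) w))).+1 by rewrite size_rev size_map.
  rewrite steps_read revK size_rev size_map addn0.
  have -> : (fun c : bool => if c then [::] else nseq (size w) None) = halves false n 0.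
    by apply: functional_extensionality => -[].
  have -> : map (Some : S -> G) w ++ [:: None] = enc [:: w] by rewrite enc_cons.
  rewrite eT0 add0n; congr (iter _ _ (_, pack _ _ _ _ _)).
  by apply: functional_extensionality => -[].
  apply: functional_extensionality => j; apply: functional_extensionality => c.
  by rewrite /clock_state /clocks ffunE subnn; case: c.
rewrite {}run_init; case: hT1 => -[-> /= hT1]; split=> //; split=> // h.
  exact: (proj1 (levels_triv R [:: w]) hT1 w (mem_head _ _)).
by case: hT1; apply/levels_triv => u; rewrite inE => /eqP->.
Qed.

End Program.

(** * Running time *)

Section RealBound.
Import Rdefinitions Raxioms RIneq Rpow_def Rfunctions Rpower.
Local Open Scope R_scope.

Lemma INR_expn a e : INR (expn a e) = INR a ^ e.
Proof. by elim: e => // e IHe; rewrite expnS -multE mult_INR IHe. Qed.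

(** For [n >= 2] the binary logarithm is at least 1, so the factor 3 absorbs the added 2. *)
Lemma log_bound n : leq 2 n -> INR (trunc_log 2 n).+2 <= 3 / ln 2 * ln (INR n).
Proof.
move=> n1; have l2 : 0 < ln 2 by have := ln_lt_2; lra.
have n2 : 2 <= INR n by have := le_INR 2 n ltac:(lia); rewrite /=; lra.
have ln2n : ln 2 <= ln (INR n) by case: n2 => [/ln_increasing|<-]; lra.
have : INR (trunc_log 2 n) * ln 2 <= ln (INR n).
  have := trunc_logP (isT : leq 2 2) (ltnW n1) => /leP/le_INR; rewrite INR_expn => h.
  rewrite -ln_pow; last by lra.
  have e2 : INR 2 = 2 by rewrite /=; lra.
  rewrite e2 in h; case: h => [h|->]; last by lra.
  by apply/Rlt_le/ln_increasing => //; apply: pow_lt; lra.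
rewrite !S_INR => h; apply: (Rmult_le_reg_r (ln 2)) => //.
have -> : 3 / ln 2 * ln (INR n) * ln 2 = 3 * ln (INR n) by field; lra.
nra.
Qed.

(** For [n <= 1], where [n_logpow] may vanish, the additive constant takes over. *)
Lemma nlog_bound D e : exists C, forall n,
  INR (muln (muln D n.+1) (expn (trunc_log 2 n).+2 e)) <= C * n_logpow e n + C.
Proof.
have l2 : 0 < ln 2 by have := ln_lt_2; lra.
pose a := (3 / ln 2) ^ e.
have a0 : 0 < a by apply: pow_lt; apply: Rdiv_lt_0_compat; lra.
have D0 : 0 <= INR D by exact: pos_INR.
have p2 : 0 < 2 ^ e by apply: pow_lt; lra.
exists (2 * INR D * a + 2 * INR D * 2 ^ e) => n.
rewrite /n_logpow -!multE !mult_INR INR_expn.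
case: (leqP n 1) => [le_n|lt_n].
  have -> : trunc_log 2 n = O by case: n le_n => [|[|]].
  have -> : INR 2 = 2 by rewrite /=; lra.
  have n1 : 0 <= INR n <= 1.
    by split; [exact: pos_INR | have := le_INR n 1 ltac:(lia)].
  have f0 : INR n * ln (INR n) ^ e >= 0.
    case: n le_n n1 => [|[|]] //= _ _; first by lra.
    rewrite ln_1; case: e {a a0 p2} => [|e] /=; lra.
  rewrite S_INR; move: f0; move: (INR n * ln (INR n) ^ e) => f f0.
  have h1 : INR D * (INR n + 1) <= INR D * 2 by apply: Rmult_le_compat_l; lra.
  have h2 : INR D * (INR n + 1) * 2 ^ e <= INR D * 2 * 2 ^ e by apply: Rmult_le_compat_r; lra.
  have h3 : 0 <= INR D * a by apply: Rmult_le_pos; lra.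
  have h4 : 0 <= INR D * 2 ^ e by apply: Rmult_le_pos; lra.
  have h5 : 0 <= (2 * INR D * a + 2 * INR D * 2 ^ e) * f by apply: Rmult_le_pos; lra.
  by lra.
have lb := log_bound lt_n.
have n2 : 2 <= INR n by have := le_INR 2 n ltac:(lia); rewrite /=; lra.
have lnn : 0 < ln (INR n) by rewrite -ln_1; apply: ln_increasing; lra.
have h1 : INR (trunc_log 2 n).+2 ^ e <= a * ln (INR n) ^ e.
  by rewrite /a -Rpow_mult_distr; apply: pow_incr; split => //; exact: pos_INR.
have h2 : 0 <= INR (trunc_log 2 n).+2 ^ e by apply: pow_le; exact: pos_INR.
have h3 : 0 < ln (INR n) ^ e by apply: pow_lt.
move: (INR (trunc_log 2 n).+2 ^ e) (ln (INR n) ^ e) h1 h2 h3 => x y h1 h2 h3.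
rewrite S_INR.
have h4 : INR D * (INR n + 1) * x <= INR D * (2 * INR n) * (a * y).
  apply: Rmult_le_compat => //; first by apply: Rmult_le_pos; lra.
  by apply: Rmult_le_compat_l; lra.
have h5 : 0 <= INR D * 2 ^ e by apply: Rmult_le_pos; lra.
have h6 : 0 <= INR D * 2 ^ e * (INR n * y).
  by apply: Rmult_le_pos => //; apply: Rmult_le_pos; lra.
have h7 : 0 <= INR D * a by apply: Rmult_le_pos; lra.
by lra.
Qed.

End RealBound.

(** Each of the [r] levels costs [O(n * r ^ d)], and [r = c * L ^ k]; hence the exponent
    [k * (d + 1)]. *)
Lemma total_bound C1 d c b k : 0 < c -> exists D, forall n,
  let L := (trunc_log 2 n).+2 in let r := c * L ^ k in
  n.+1 + (4 * n + 3 + r * (2 * (2 * (n * (C1 * r.+1 ^ d)) + n.+1) + b)).*2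
  <= D * n.+1 * L ^ (k * d.+1).
Proof.
move=> c0; exists (9 + 2 * (c * (4 * (C1 * (2 * c) ^ d) + 2 + b))) => n; cbv zeta; set L := (trunc_log 2 n).+2; set r := c * L ^ k.
rewrite expnM; have : 0 < L ^ k by rewrite expn_gt0.
rewrite /r; move: (L ^ k) => q q0 {r}.
have h1 : (c * q).+1 ^ d <= (2 * c) ^ d * q ^ d.
  by rewrite -expnMn; apply: leq_expn_r; nia.
have qd : 0 < q ^ d by rewrite expn_gt0 q0.
rewrite expnS; move: ((c * q).+1 ^ d) (q ^ d) ((2 * c) ^ d) h1 qd => x y z h1 y0.
have h2 : 2 * (2 * (n * (C1 * x)) + n.+1) + b <= (4 * (C1 * z) + 2 + b) * n.+1 * y.
  have h3 : C1 * x <= C1 * z * y by rewrite -mulnA leq_mul2l h1 orbT.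
  move: (C1 * x) (C1 * z) h3 => u v h3.
  have : n * u <= n * (v * y) by rewrite leq_mul2l h3 orbT.
  nia.
have h4 := leq_mul (leqnn (c * q)) h2.
move: h4; move: (c * q * _) => u; move: (4 * (C1 * z) + 2 + b) => v.
have -> : c * q * (v * n.+1 * y) = c * v * (n.+1 * (q * y)) by lia.
have : n.+1 * 1 <= n.+1 * (q * y) by rewrite leq_mul2l muln_gt0 q0 y0 orbT.
by rewrite -[X in _ -> _ -> _ <= X]mulnA; move: (n.+1 * (q * y)) => P; lia.
Qed.

(** * From a detection depth to a time bound *)

Section Main.
Variables (X S : finType) (t : S -> X -> S) (o : S -> X -> X) (d : nat).

Lemma DTIME_always (Sigma : finType) (L : seq Sigma -> Prop) f :
  (forall w, L w) -> DTIME_star f L.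
Proof.
move=> Lw.
pose M := @MkTM Sigma 0 unit (option Sigma) None Some (@Some_inj _) (fun a e => ltac:(discriminate e))
  tt xpredT xpredT (fun q r => (q, r, [ffun=> ord0])).
exists M, (INR 0) => w; exists 0; split=> //.
rewrite /=; Lra.lra.
Qed.

Lemma WP_DTIME (nt : S -> bool) (x0 : X) k :
  invertible o -> minimal t o -> (forall s, nt s <-> nontrivial_state t o s) ->
  poly_bounded t o d ->
  (exists B, forall w j, size w <= 2 ^ j ->
     (forall v, size v <= j.+3 ^ k.+1 * B -> act_word t o w v = v) -> WP t o w) ->
  DTIME_star (n_logpow (k.+1 * d.+1)) (WP t o).
Proof.
move=> o_inj S_min ntP S_poly [B det].
have [C1 bnd] := poly_growth ntP S_poly.
(* Since [j + 3 <= 3 * (j + 1)], this factor makes the number of levels counted by the odometer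
   exceed the detection depth. *)
pose C := 3 ^ k.+1 * B.
have [D le_D] := total_bound C1 d (#|X| + k.+2) k.+1 (ltn0Sn C).
have [c le_c] := nlog_bound D (k.+1 * d.+1).
pose T n := 4 * n + 3 + level_count C k n *
  (2 * (2 * (n * (C1 * (level_count C k n).+1 ^ d)) + n.+1) + (#|X| + k.+2)).
have Some_injS : injective (Some : S -> option S) by move=> a b [].
exists (sim Some_injS Qstart (@prog_halt X C k) (@prog_acc X C k)
          (@prog_sel X x0 C k) (@prog_nxt X S t o nt C k)), c => w.
have dec u : exists m, let q := (sm_run Some Qstart (@prog_halt X C k)
    (@prog_sel X x0 C k) (@prog_nxt X S t o nt C k) m u).1 in
    [/\ m <= T (size u), prog_halt q & prog_acc q <-> WP t o u].
  have [m [le_m hm am]] := program_decides x0 C k o_inj ntP u bnd.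
  exists m; split=> //; rewrite am; split=> [h|h v _]; last exact: h.
  apply: (det u (log_size (size u))).
    by apply/ltnW/trunc_log_ltn.
  move=> v szv; apply: h; apply: leq_trans szv _.
  rewrite /level_count /C; apply: leq_trans (_ : 3 ^ k.+1 * B * (log_size (size u)).+1 ^ k.+1 <= _).
    by rewrite mulnAC -expnMn leq_mul2r leq_expn_r ?orbT //; lia.
  by rewrite leq_mul2r leqnSn orbT.
have [n0 [le_n hn an]] := sim_decides Some_injS dec w.
exists n0; split=> //; apply: RIneq.Rle_trans (le_c (size w)).
by apply: RIneq.le_INR; apply/leP; apply: leq_trans le_n _; exact: le_D.
Qed.

End Main.

Theorem mainTheorem11 (X S : finType) (t : S -> X -> S) (o : S -> X -> X) (d : nat) :
  invertible o -> minimal t o -> closed_under_inversion t o ->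
  automaton_degree t o d ->
  DTIME_star (n_logpow ((d + 1) ^ 2)) (WP t o) /\
  (contracting t o -> DTIME_star (n_logpow (d + 1)) (WP t o)).
Proof.
move=> o_inj S_min _ [S_poly _].
(* Classical logic turns nontriviality into a finite table that the transition function can
   consult. *)
have /fin_all_exists[nt ntP] : forall s, exists b : bool, b <-> nontrivial_state t o s.
  move=> s; case: (classic (nontrivial_state t o s)) => h; [exists true|exists false]; split=> //.
(* Over an empty alphabet only the empty word exists, and every [w] lies in [WP]. *)
case: (pickP X) => [x0 _|X0]; last first.
  have WP_all w : WP t o w by case=> [|x]; [apply: size0nil; rewrite size_act_word | have := X0 x].
  by split=> [|_]; exact: DTIME_always.
rewrite addn1; split=> [|ctr].
  by apply: (@WP_DTIME _ _ t o d nt x0 d) => //; exact: detect_depth.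
(* Contraction lowers the exponent of the depth from [d + 1] to 1. *)
rewrite -[d.+1]mul1n; apply: (@WP_DTIME _ _ t o d nt x0 0) => //.
have [B det] := contracting_depth x0 o_inj S_min ntP S_poly ctr.
by exists B => w j; rewrite expn1; exact: det.
Qed.
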